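(* The properad $\mathsf{BIB}_d$ of degree $d$ balanced infinitesimal bialgebras is not Koszul.
   Context: Work over a field $\mathbb{K}$ of characteristic zero; $d\in\mathbb{Z}$. Ribbon quivers. A ribbon graph is a triple consisting of a finite set of half-edges, a fixed-point-free involution $\sigma_1$ on it (orbits are edges) and a permutation $\sigma_0$ of it (cycles are vertices, so half-edges at a vertex are cyclically ordered). A ribbon quiver is a connected ribbon graph with a fixed direction on each edge and no closed directed path. The dg properad $\mathcal{P}re\mathcal{CY}^3_d$. A haired ribbon quiver is a ribbon quiver in which each vertex may in addition carry in-hairs (incoming legs) and out-hairs (outgoing legs); all half-legs (half-edges and hairs) at a vertex are cyclically ordered. $\mathcal{P}re\mathcal{CY}^3_d(p,q)$ ($p,q\ge1$) is spanned by haired ribbon quivers with $p$ labelled out-hairs and $q$ labelled in-hairs in which every vertex has valency $\ge3$ (counting half-edges and hairs), at least one incoming half-leg and at least one outgoing half-leg. The degree is $|\Gamma|=d\#V+(1-d)\#E+(2-d)\#H_{out}-\#H_{in}$, with orientation a unit vector of $\det E\otimes\det H_{in}$ for $d$ even, of $\det V\otimes\det(H_{out}\sqcup H_{in})$ for $d$ odd. Properadic compositions glue out-hairs to in-hairs, producing new edges. The differential $\delta$ splits each vertex $v$ into $\bullet\to\bullet$ and redistributes the half-legs of $v$ in all ways respecting cyclic orders, discarding any graph with a vertex of valency $\le 2$, or with a vertex having no incoming or no outgoing half-legs. As a properad it is free, generated by one-vertex haired ribbon quivers (ribbon corollas). The properad $\mathsf{BIB}_d$. Let $I$ be the ideal of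 $\mathcal{P}re\mathcal{CY}^3_d$ generated by haired ribbon quivers with at least one vertex of valency $\ge4$, and $\hat I$ its differential closure. Then $\mathsf{BIB}_d:=\mathcal{P}re\mathcal{CY}^3_d/\hat I$, which has zero differential; it is a quadratic properad generated by planar corollas with one output and two inputs (spanning $\mathbb{K}[\mathbb{S}_2][1]$) and planar corollas with two outputs and one input (spanning $\mathbb{K}[\mathbb{S}_2][d-2]$). Koszulness. $\mathcal{P}re\mathcal{CY}^3_d$ is the cobar construction on the Koszul dual of $\mathsf{BIB}_d$; accordingly $\mathsf{BIB}_d$ is Koszul if and only if the canonical projection $\mathcal{P}re\mathcal{CY}^3_d\to\mathsf{BIB}_d$ is a quasi-isomorphism. *)

(* Defs.v *)
From HB Require Import structures.
From mathcomp Require Import all_boot all_order all_algebra all_fingroup.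
From mathcomp Require Import generic_quotient boolp finmap.
From mathcomp Require Import monalg.

Set Implicit Arguments.
Unset Strict Implicit.
Unset Printing Implicit Defensive.

Import GRing.Theory Num.Theory.
Local Open Scope ring_scope.
Local Open Scope quotient_scope.

Section Span.
Variables (K : nzRingType) (V : lmodType K) (S : V -> Prop).

Inductive lspan : V -> Prop :=
| lspan0 : lspan 0
| lspanZD c x y : S x -> lspan y -> lspan (c *: x + y).

Lemma lspan_in x : S x -> lspan x.
Proof. by move=> Sx; have := lspanZD 1 Sx lspan0; rewrite scale1r addr0. Qed.

Lemma lspanD x y : lspan x -> lspan y -> lspan (x + y).
Proof.
by elim=> [|c u v Su _ IH] Ly; rewrite ?add0r // -addrA; apply: lspanZD (IH Ly).
Qed.

Lemma lspanZ c x : lspan x -> lspan (c *: x).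
Proof.
elim=> [|b u v Su _ IH]; first by rewrite scaler0; apply: lspan0.
by rewrite scalerDr scalerA; apply: lspanZD.
Qed.

Lemma lspanB x y : lspan x -> lspan y -> lspan (x - y).
Proof. by move=> Lx Ly; rewrite -scaleN1r; apply/lspanD/lspanZ. Qed.

Definition lspan_eqv : rel V := fun x y => `[< lspan (x - y) >].

Lemma lspan_eqv_class : equiv_class_of lspan_eqv.
Proof.
split=> [x|x y|y x z].
- by apply/asboolP; rewrite subrr; apply: lspan0.
- by apply/asboolP/asboolP => /(lspanZ (-1)); rewrite scaleN1r opprB.
- move=> /asboolP Lxy /asboolP Lyz; apply/asboolP.
  by have := lspanD Lxy Lyz; rewrite addrA subrK.
Qed.

Canonical lspan_eqv_equiv := EquivRelPack lspan_eqv_class.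

Definition lquot := {eq_quot lspan_eqv}.
HB.instance Definition _ := Choice.on lquot.
HB.instance Definition _ := EqQuotient.on lquot.

Lemma lquotP x y : \pi_lquot x = \pi_lquot y <-> lspan (x - y).
Proof.
split; first by move/eqmodP/asboolP.
by move=> Lxy; apply/eqmodP/asboolP.
Qed.

Definition lquot_add (u v : lquot) : lquot := \pi_lquot (repr u + repr v).
Definition lquot_opp (u : lquot) : lquot := \pi_lquot (- repr u).
Definition lquot_scale (c : K) (u : lquot) : lquot := \pi_lquot (c *: repr u).

Lemma lquot_repr x : lspan (repr (\pi_lquot x) - x).
Proof. by apply/lquotP; rewrite reprK. Qed.

Lemma lquot_addE x y :
  lquot_add (\pi_lquot x) (\pi_lquot y) = \pi_lquot (x + y).
Proof.
apply/lquotP; rewrite opprD addrACA.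
exact: lspanD (lquot_repr x) (lquot_repr y).
Qed.

Lemma lquot_oppE x : lquot_opp (\pi_lquot x) = \pi_lquot (- x).
Proof.
apply/lquotP; have := lspanZ (-1) (lquot_repr x).
by rewrite scaleN1r opprD.
Qed.

Lemma lquot_scaleE c x : lquot_scale c (\pi_lquot x) = \pi_lquot (c *: x).
Proof. by apply/lquotP; rewrite -scalerBr; apply/lspanZ/lquot_repr. Qed.

Lemma lquot_addA : associative lquot_add.
Proof.
move=> u v w; elim/quotW: u => x; elim/quotW: v => y; elim/quotW: w => z.
by rewrite (lquot_addE y z) (lquot_addE x y) !lquot_addE addrA.
Qed.
Lemma lquot_addC : commutative lquot_add.
Proof.
by move=> u v; elim/quotW: u => x; elim/quotW: v => y; rewrite !lquot_addE addrC.
Qed.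
Lemma lquot_add0 : left_id (\pi_lquot 0) lquot_add.
Proof. by move=> u; elim/quotW: u => x; rewrite lquot_addE add0r. Qed.
Lemma lquot_addN : left_inverse (\pi_lquot 0) lquot_opp lquot_add.
Proof. by move=> u; elim/quotW: u => x; rewrite lquot_oppE lquot_addE addNr. Qed.

HB.instance Definition _ := GRing.isZmodule.Build lquot
  lquot_addA lquot_addC lquot_add0 lquot_addN.

Lemma lquot_scaleA a b u :
  lquot_scale a (lquot_scale b u) = lquot_scale (a * b) u.
Proof. by elim/quotW: u => x; rewrite (lquot_scaleE b) !lquot_scaleE scalerA. Qed.
Lemma lquot_scale1 : left_id 1 lquot_scale.
Proof. by move=> u; elim/quotW: u => x; rewrite lquot_scaleE scale1r. Qed.
Lemma lquot_scaleDr : right_distributive lquot_scale +%R.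
Proof.
move=> c u v; elim/quotW: u => x; elim/quotW: v => y.
have -> : \pi_lquot x + \pi_lquot y = \pi_lquot (x + y) by exact: lquot_addE.
by rewrite !lquot_scaleE scalerDr; apply/esym/lquot_addE.
Qed.
Lemma lquot_scaleDl u : {morph lquot_scale^~ u : a b / a + b}.
Proof.
move=> a b; elim/quotW: u => x; rewrite !lquot_scaleE scalerDl.
exact/esym/lquot_addE.
Qed.

HB.instance Definition _ := GRing.Zmodule_isLmodule.Build K lquot
  lquot_scaleA lquot_scale1 lquot_scaleDr lquot_scaleDl.

Definition lproj (x : V) : lquot := \pi_lquot x.

Lemma lproj_is_linear : linear lproj.
Proof.
by move=> c x y; rewrite /lproj -lquot_addE -lquot_scaleE.
Qed.
HB.instance Definition _ := GRing.isLinear.Build K V lquot _ lproj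
  lproj_is_linear.

Lemma lproj_eq0 x : lproj x = 0 <-> lspan x.
Proof. by rewrite -[0](linear0 lproj) lquotP subr0. Qed.

Lemma lproj_repr u : lproj (repr u) = u.
Proof. exact: reprK. Qed.

End Span.

Section InducedMap.
Variables (K : nzRingType) (V W : lmodType K) (S : V -> Prop) (T : W -> Prop).
Variable f : {linear V -> W}.

Definition lquot_map (fS : forall x, S x -> lspan T (f x)) (u : lquot S) : lquot T :=
  lproj T (f (repr u)).

Variable fS : forall x, S x -> lspan T (f x).

Lemma lquot_mapE x : lquot_map fS (lproj S x) = lproj T (f x).
Proof.
apply/eqP; rewrite -subr_eq0 -!linearB; apply/eqP/lproj_eq0.
elim: (lquot_repr S x) => [|c u v Su _ IH]; first by rewrite linear0; apply: lspan0.
by rewrite linearP; apply: lspanD IH; apply/lspanZ/fS.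
Qed.

Lemma lquot_map_is_linear : linear (lquot_map fS).
Proof.
move=> c u v; rewrite -[u]lproj_repr -[v]lproj_repr -linearP !lquot_mapE.
by rewrite !linearP.
Qed.
HB.instance Definition _ :=
  GRing.isLinear.Build K (lquot S) (lquot T) _ (lquot_map fS)
    lquot_map_is_linear.

End InducedMap.

Section LinearExtension.
Variables (K : nzRingType) (T : choiceType) (V : lmodType K) (h : T -> V).

Definition linext (f : {malg K[T]}) : V := \sum_(t <- msupp f) f@_t *: h t.

Lemma linextE (D : {fset T}) f : (msupp f `<=` D)%fset ->
  linext f = \sum_(t <- D) f@_t *: h t.
Proof.
move=> le; rewrite [LHS](big_fset_incl _ le) // => t _ /mcoeff_outdom ->.
by rewrite scale0r.
Qed.

Lemma linextU t : linext << t >> = h t.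
Proof.
by rewrite (linextE msuppU_le) big_seq_fset1 mcoeffUU scale1r.
Qed.

Lemma linext_is_linear : linear linext.
Proof.
move=> c f g; pose D := (msupp f `|` msupp g `|` msupp (c *: f + g))%fset.
rewrite !(@linextE D) ?scaler_sumr -?big_split /=.
- by apply: eq_bigr => t _; rewrite mcoeffD mcoeffZ scalerDl scalerA.
- by rewrite fsubsetU // fsubsetUr.
- by rewrite fsubsetU // fsubsetUl.
- by rewrite fsubsetUr.
Qed.
HB.instance Definition _ := GRing.isLinear.Build K {malg K[T]} V _ linext
  linext_is_linear.

End LinearExtension.

(* The half-legs of a graph with e edges, p out-hairs and q in-hairs.  Each   *)
(* directed edge j has an outgoing half (at its source vertex) and an         *)
(* incoming half (at its target vertex), so that the involution exchanging    *)
(* the two halves of an edge is esrc j <-> etgt j.                            *)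
Definition hleg (e p q : nat) : finType := (('I_e + 'I_p) + ('I_e + 'I_q))%type.

Section HalfLegs.
Variables e p q : nat.
Definition esrc (j : 'I_e) : hleg e p q := inl (inl j).
Definition hout (i : 'I_p) : hleg e p q := inl (inr i).
Definition etgt (j : 'I_e) : hleg e p q := inr (inl j).
Definition hin (i : 'I_q) : hleg e p q := inr (inr i).
Definition outgoing (h : hleg e p q) : bool := if h is inl _ then true else false.
End HalfLegs.
Arguments esrc {e p q}.
Arguments hout {e p q}.
Arguments etgt {e p q}.
Arguments hin {e p q}.

(* Directed ribbon graphs with labelled vertices, edges and hairs: cyc is the *)
(* permutation whose cycles are the vertices, and vtx names the vertex of     *)
(* each half-leg.  The labels of the vertices and of the edges serve to write *)
(* down orientations; they are divided out by iso_rel below.                  *)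
Record ribbon (v e p q : nat) := Ribbon {
  cyc : {perm hleg e p q};
  vtx : {ffun hleg e p q -> 'I_v} }.

Section RibbonFinType.
Variables v e p q : nat.
Definition ribbon_pair (G : ribbon v e p q) := (cyc G, vtx G).
Definition pair_ribbon x : ribbon v e p q := Ribbon x.1 x.2.
Lemma ribbon_pairK : cancel ribbon_pair pair_ribbon. Proof. by case. Qed.
HB.instance Definition _ :=
  Finite.copy (ribbon v e p q) (can_type ribbon_pairK).
End RibbonFinType.

Section HairedQuivers.
Variables v e p q : nat.
Implicit Type G : ribbon v e p q.

Definition arrow G : rel 'I_v :=
  fun u w => [exists j, (vtx G (esrc j) == u) && (vtx G (etgt j) == w)].

Definition adjacent G : rel 'I_v := fun u w => arrow G u w || arrow G w u.

Definition vertices_are_cycles G :=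
  [forall x, forall y, (vtx G x == vtx G y) == (y \in porbit (cyc G) x)].

Definition connected G :=
  (0 < v)%N && [forall u, forall w, connect (adjacent G) u w].

Definition no_directed_cycle G :=
  [forall u, forall w, arrow G u w ==> ~~ connect (arrow G) w u].

Definition good_vertex G (u : 'I_v) :=
  [&& 3 <= #|[set h | vtx G h == u]|,
      [exists h, (vtx G h == u) && ~~ outgoing h] &
      [exists h, (vtx G h == u) && outgoing h]]%N.

Definition admissible G :=
  [&& vertices_are_cycles G, connected G, no_directed_cycle G
    & [forall u, good_vertex G u]].

Definition has_valency_ge4 G :=
  [exists u, 4 <= #|[set h | vtx G h == u]|]%N.

End HairedQuivers.

Definition quiver (v e p q : nat) := {G : ribbon v e p q | admissible G}.

Definition hquiver (p q : nat) : choiceType :=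
  {ve : nat * nat & quiver ve.1 ve.2 p q}.

Definition to_hquiver v e p q (G : quiver v e p q) : hquiver p q :=
  @Tagged _ (v, e) (fun ve => quiver ve.1 ve.2 p q) G.

Definition hq_graph p q (G : hquiver p q) :
  ribbon (tag G).1 (tag G).2 p q := val (tagged G).

Definition hq_degree (d : int) p q (G : hquiver p q) : int :=
  d * (tag G).1%:Z + (1 - d) * (tag G).2%:Z + (2 - d) * p%:Z - q%:Z.

Section SumPerm.
Variables A B : finType.
Definition sum_fun (s : {perm A}) (t : {perm B}) (x : A + B) : A + B :=
  match x with inl a => inl (s a) | inr b => inr (t b) end.
Lemma sum_fun_inj s t : injective (sum_fun s t).
Proof. by move=> [x|x] [y|y] //= [/perm_inj ->]. Qed.
Definition sum_perm s t : {perm A + B} := perm (@sum_fun_inj s t).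
End SumPerm.

Definition hleg_perm e p q (s : 'S_e) (a : 'S_p) (b : 'S_q) :
  {perm hleg e p q} := sum_perm (sum_perm s a) (sum_perm s b).

Definition relabel v e p q (t : 'S_v) (s : 'S_e) (a : 'S_p) (b : 'S_q)
    (G : ribbon v e p q) : ribbon v e p q :=
  let l := hleg_perm s a b in
  Ribbon (cyc G ^ l)%g [ffun h => t (vtx G ((l^-1)%g h))].

(* The sign by which a relabelling acts on orientations: these live in        *)
(* det E (x) det H_in for d even and in det V (x) det (H_out + H_in) for d    *)
(* odd.                                                                       *)
Definition or_sign (K : nzRingType) (d : int) v e p q
    (t : 'S_v) (s : 'S_e) (a : 'S_p) (b : 'S_q) : K :=
  if odd `|d|%N then (-1) ^+ (odd_perm t (+) odd_perm a (+) odd_perm b)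
  else (-1) ^+ (odd_perm s (+) odd_perm b).

Section Splitting.
Variables v e p q : nat.

(* The half-legs of the original graph inside a graph with one more edge, the *)
(* new edge being number 0.                                                   *)
Definition old (h : hleg e p q) : hleg e.+1 p q :=
  match h with
  | inl (inl j) => esrc (lift ord0 j) | inl (inr i) => hout i
  | inr (inl j) => etgt (lift ord0 j) | inr (inr i) => hin i
  end.

Definition is_old (h : hleg e.+1 p q) : option (hleg e p q) :=
  match h with
  | inl (inl j) => omap esrc (unlift ord0 j) | inl (inr i) => Some (hout i)
  | inr (inl j) => omap etgt (unlift ord0 j) | inr (inr i) => Some (hin i)
  end.

Lemma oldK : pcancel old is_old.
Proof. by move=> [[j|i]|[j|i]] //=; rewrite liftK. Qed.

Lemma is_old_src : is_old (esrc ord0) = None.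
Proof. by rewrite /= unlift_none. Qed.

Lemma is_old_tgt : is_old (etgt ord0) = None.
Proof. by rewrite /= unlift_none. Qed.

Lemma old_inj : injective old. Proof. exact: pcan_inj oldK. Qed.

Variant is_old_spec h : option (hleg e p q) -> Type :=
| IsOld h' of h = old h' : is_old_spec h (Some h')
| IsSrc of h = esrc ord0 : is_old_spec h None
| IsTgt of h = etgt ord0 : is_old_spec h None.

Lemma is_oldP h : is_old_spec h (is_old h).
Proof.
case: h => [[j|i]|[j|i]] /=; try by constructor.
- by case: unliftP => [j' ->|->]; constructor.
- by case: unliftP => [j' ->|->]; constructor.
Qed.

Definition extend_fun (c : {perm hleg e p q}) (h : hleg e.+1 p q) :=
  if is_old h is Some h' then old (c h') else h.

Lemma extend_fun_inj c : injective (extend_fun c).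
Proof.
move=> x y; rewrite /extend_fun.
case: is_oldP => [x' ->|->|->]; case: is_oldP => [y' ->|->|->] //;
  by [move/old_inj/perm_inj ->
     |move=> /(congr1 is_old); rewrite oldK ?is_old_src ?is_old_tgt].
Qed.

Definition extend c : {perm hleg e.+1 p q} := perm (@extend_fun_inj c).

Lemma extendE c h : extend c h = extend_fun c h.
Proof. by rewrite permE. Qed.

(* For two distinct half-legs a, b of the same vertex, with cycle             *)
(*   (a .. a' b .. b')                                                        *)
(* splitting a b replaces this vertex by the two vertices                     *)
(*   (esrc 0  a .. a')   and   (etgt 0  b .. b')                              *)
(* joined by the new edge 0: the new half-edges are first inserted before a   *)
(* and b, and the final transposition cuts the resulting cycle in two.  The   *)
(* source of the new edge is the new vertex 0, and its target keeps the label *)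
(* of the vertex that has been split.                                         *)
Definition splitting (G : ribbon v e p q) (a b : hleg e p q) :
    ribbon v.+1 e.+1 p q :=
  let c := (extend (cyc G) * tperm (esrc ord0) (old a) * tperm (etgt ord0) (old b)
            * tperm (esrc ord0) (etgt ord0))%g in
  Ribbon c [ffun h => if h \in porbit c (esrc ord0) then ord0
                      else lift ord0 (vtx G (odflt b (is_old h)))].

End Splitting.

Section Gluing.
Variables v1 e1 p1 q1 v2 e2 p2 q2 k : nat.

Let e := (e1 + e2 + k)%N.
Let hleg1 := hleg e1 (p1 + k) q1.
Let hleg2 := hleg e2 p2 (k + q2).
Let hlegG := hleg e (p1 + p2) (q1 + q2).

(* Gluing the last k out-hairs of a first graph to the first k in-hairs of a  *)
(* second one.                                                                *)
Definition glue_leg (h : hleg1 + hleg2) : hlegG :=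
  match h with
  | inl (inl (inl j)) => esrc (lshift k (lshift e2 j))
  | inl (inl (inr i)) => match fintype.split i with
                         | inl i' => hout (lshift p2 i')
                         | inr j => esrc (rshift (e1 + e2) j)
                         end
  | inl (inr (inl j)) => etgt (lshift k (lshift e2 j))
  | inl (inr (inr i)) => hin (lshift q2 i)
  | inr (inl (inl j)) => esrc (lshift k (rshift e1 j))
  | inr (inl (inr i)) => hout (rshift p1 i)
  | inr (inr (inl j)) => etgt (lshift k (rshift e1 j))
  | inr (inr (inr i)) => match fintype.split i with
                         | inl j => etgt (rshift (e1 + e2) j)
                         | inr i' => hin (rshift q1 i')
                         end
  end.

Definition unglue_leg (h : hlegG) : hleg1 + hleg2 :=
  match h with
  | inl (inl j) => match fintype.split j with
                   | inl j' => match fintype.split j' with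
                               | inl j1 => inl (esrc j1)
                               | inr j2 => inr (esrc j2)
                               end
                   | inr i => inl (hout (rshift p1 i))
                   end
  | inl (inr i) => match fintype.split i with
                   | inl i1 => inl (hout (lshift k i1))
                   | inr i2 => inr (hout i2)
                   end
  | inr (inl j) => match fintype.split j with
                   | inl j' => match fintype.split j' with
                               | inl j1 => inl (etgt j1)
                               | inr j2 => inr (etgt j2)
                               end
                   | inr i => inr (hin (lshift q2 i))
                   end
  | inr (inr i) => match fintype.split i with
                   | inl i1 => inl (hin i1)
                   | inr i2 => inr (hin (rshift k i2))
                   end
  end.

Lemma glue_legK : cancel glue_leg unglue_leg.
Proof.
by move=> [[[j|i]|[j|i]]|[[j|i]|[j|i]]] /=;
   rewrite ?(unsplitK (inl _)) ?(unsplitK (inr _)) //;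
   case: split_ordP => j -> /=;
   rewrite ?(unsplitK (inl _)) ?(unsplitK (inr _)).
Qed.

Lemma unglue_legK : cancel unglue_leg glue_leg.
Proof.
by move=> [[j|i]|[j|i]] /=; case: split_ordP => j' -> /=;
   rewrite ?(unsplitK (inl _)) ?(unsplitK (inr _)) //;
   case: split_ordP => j'' -> /=.
Qed.

Definition glue_fun (c1 : {perm hleg1}) (c2 : {perm hleg2}) (h : hlegG) : hlegG :=
  glue_leg (sum_perm c1 c2 (unglue_leg h)).

Lemma glue_fun_inj c1 c2 : injective (glue_fun c1 c2).
Proof.
move=> x y /(can_inj glue_legK)/perm_inj; exact: can_inj unglue_legK _ _.
Qed.

Definition gluing (G1 : ribbon v1 e1 (p1 + k) q1) (G2 : ribbon v2 e2 p2 (k + q2)) :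
    ribbon (v1 + v2) e (p1 + p2) (q1 + q2) :=
  Ribbon (perm (@glue_fun_inj (cyc G1) (cyc G2)))
    [ffun h => match unglue_leg h with
               | inl h1 => lshift v2 (vtx G1 h1)
               | inr h2 => rshift v1 (vtx G2 h2)
               end].

(* The sign identifying or_1 /\ or_2 with the orientation of the glued graph. *)
(* For d even, E1 Hin1 E2 (Hin2' Hin2'') becomes (E1 E2 Hin2') (Hin1 Hin2''), *)
(* where each glued in-hair in Hin2' is replaced by the new edge that ends at *)
(* it.  For d odd,                                                            *)
(*   V1 (Hout1' Hout1'' Hin1) V2 (Hout2 Hin2' Hin2'')                         *)
(* becomes V1 V2 (Hout1' Hout2 Hin1 Hin2''), after the k glued pairs          *)
(* (out-hair, in-hair) have been made adjacent and deleted.                   *)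
Definition glue_sign (K : nzRingType) (d : int) : K :=
  if odd `|d|%N
  then (-1) ^+ (v2 * (p1 + k + q1) + k * (p2 + q1) + 'C(k, 2) + q1 * p2)
  else (-1) ^+ (q1 * (e2 + k)).

End Gluing.

Section GraphSpace.
Variables (K : fieldType) (d : int) (p q : nat).

Definition graph_space : lmodType K := {malg K[hquiver p q]}.

(* A labelled graph with the orientation given by the order of the labels, or *)
(* 0 if it is not an admissible haired ribbon quiver.                         *)
Definition gen v e (G : ribbon v e p q) : graph_space :=
  if insub G is Some G' then << to_hquiver G' >> else 0.

Definition iso_rel (x : graph_space) : Prop :=
  exists v e (t : 'S_v) (s : 'S_e) (G : ribbon v e p q),
    x = gen (relabel t s 1 1 G)
        - or_sign K d t s (1 : 'S_p)%g (1 : 'S_q)%g *: gen G.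

Definition PreCY : lmodType K := lquot iso_rel.

(* The new edge is put in front of the orientation for d even, and the split  *)
(* vertex v is replaced by (source of the new edge) /\ (target) for d odd.    *)
(* With the labelling of splitting, both rules come without signs.            *)
Definition graph_diff : graph_space -> graph_space :=
  linext (fun G : hquiver p q =>
    \sum_a \sum_(b | (b != a) && (vtx (hq_graph G) b == vtx (hq_graph G) a))
      gen (splitting (hq_graph G) a b)).

HB.instance Definition _ := GRing.Linear.on graph_diff.

End GraphSpace.

Arguments gen K {p q v e} G.
Arguments graph_diff {K p q} x.

Section RelabelTheory.

Lemma sum_permM (A B : finType) (s s' : {perm A}) (t t' : {perm B}) :
  (sum_perm s t * sum_perm s' t' = sum_perm (s * s') (t * t'))%g.
Proof. by apply/permP => -[x|x]; rewrite !permE /= !permE /= ?permE. Qed.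

Lemma sum_perm1 (A B : finType) : sum_perm (1 : {perm A}) (1 : {perm B}) = 1%g.
Proof. by apply/permP => -[x|x]; rewrite !permE /= ?permE. Qed.

Lemma hleg_permV e p q (s : 'S_e) (a : 'S_p) (b : 'S_q) :
  hleg_perm s^-1 a^-1 b^-1 = (hleg_perm s a b)^-1%g.
Proof.
by apply/eqP; rewrite eq_sym eq_invg_mul !sum_permM !mulgV !sum_perm1.
Qed.

Lemma outgoing_hleg_perm e p q (s : 'S_e) (a : 'S_p) (b : 'S_q) h :
  outgoing (hleg_perm s a b h) = outgoing h.
Proof. by case: h => h; rewrite permE. Qed.

Lemma hleg_perm_src e p q (s : 'S_e) (a : 'S_p) (b : 'S_q) j :
  hleg_perm s a b (esrc j) = esrc (s j).
Proof. by rewrite permE /= permE. Qed.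

Lemma hleg_perm_tgt e p q (s : 'S_e) (a : 'S_p) (b : 'S_q) j :
  hleg_perm s a b (etgt j) = etgt (s j).
Proof. by rewrite permE /= permE. Qed.

Lemma hleg_perm_out e p q (s : 'S_e) (a : 'S_p) (b : 'S_q) i :
  hleg_perm s a b (hout i) = hout (a i).
Proof. by rewrite permE /= permE. Qed.

Lemma hleg_perm_in e p q (s : 'S_e) (a : 'S_p) (b : 'S_q) i :
  hleg_perm s a b (hin i) = hin (b i).
Proof. by rewrite permE /= permE. Qed.

Lemma mem_porbitJ (T : finType) (c l : {perm T}) x y :
  (l y \in porbit (c ^ l)%g (l x)) = (y \in porbit c x).
Proof.
apply/porbitP/porbitP => -[i Ei]; exists i; last by rewrite Ei -conjXg permJ.
by apply: (@perm_inj _ l); rewrite Ei -conjXg permJ.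
Qed.

Lemma connect_homo (T T' : finType) (f : T -> T') (r : rel T) (r' : rel T') :
  {homo f : x y / r x y >-> r' x y} ->
  {homo f : x y / connect r x y >-> connect r' x y}.
Proof.
move=> hf x y /connectP[s]; elim: s x => [|z s IH] x /=; first by move=> _ ->.
by case/andP=> /hf/connect1 rxz /IH h /h; apply: connect_trans.
Qed.

Lemma connect_perm (T : finType) (t : {perm T}) (r r' : rel T) :
  (forall x y, r' (t x) (t y) = r x y) ->
  forall x y, connect r' (t x) (t y) = connect r x y.
Proof.
move=> h x y; apply/idP/idP; last by apply: connect_homo => u w; rewrite h.
move=> /(@connect_homo _ _ (t^-1)%g r' r) hc; rewrite -[x](permK t) -[y](permK t).
by apply: hc => u w; rewrite -h !permKV.
Qed.

Variables (v e p q : nat) (t : 'S_v) (s : 'S_e) (a : 'S_p) (b : 'S_q).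
Implicit Type G : ribbon v e p q.
Let l := hleg_perm s a b.

Lemma vtx_relabel G h : vtx (relabel t s a b G) (l h) = t (vtx G h).
Proof. by rewrite ffunE permK. Qed.

Lemma relabelK G :
  relabel t^-1 s^-1 a^-1 b^-1 (relabel t s a b G) = G.
Proof.
case: G => c f; rewrite /relabel /= hleg_permV conjgK; congr Ribbon.
by apply/ffunP => h; rewrite !ffunE invgK !permK.
Qed.

Lemma arrow_relabel G u w : arrow (relabel t s a b G) (t u) (t w) = arrow G u w.
Proof.
apply/existsP/existsP => -[j].
  rewrite -[j](permKV s) -(hleg_perm_src _ a b) -(hleg_perm_tgt _ a b).
  by rewrite !vtx_relabel !(inj_eq perm_inj); exists ((s^-1)%g j).
exists (s j); rewrite -(hleg_perm_src _ a b) -(hleg_perm_tgt _ a b).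
by rewrite !vtx_relabel !(inj_eq perm_inj).
Qed.

Lemma forall_perm (T : finType) (r : {perm T}) (P : pred T) :
  [forall x, P (r x)] = [forall x, P x].
Proof.
apply/forallP/forallP => h x //; by rewrite -[x](permKV r).
Qed.

Lemma exists_perm (T : finType) (r : {perm T}) (P : pred T) :
  [exists x, P (r x)] = [exists x, P x].
Proof.
apply/existsP/existsP => -[x Px]; first by exists (r x).
by exists ((r^-1)%g x); rewrite permKV.
Qed.

Lemma admissible_relabel G : admissible (relabel t s a b G) = admissible G.
Proof.
congr [&& _, _, _ & _].
- rewrite /vertices_are_cycles -(forall_perm l); apply: eq_forallb => x.
  rewrite -(forall_perm l); apply: eq_forallb => y.
  by rewrite !vtx_relabel (inj_eq perm_inj) mem_porbitJ.
- congr (_ && _); rewrite -(forall_perm t); apply: eq_forallb => u.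
  rewrite -(forall_perm t); apply: eq_forallb => w.
  by apply: connect_perm => x y; rewrite /adjacent !arrow_relabel.
- rewrite /no_directed_cycle -(forall_perm t); apply: eq_forallb => u.
  rewrite -(forall_perm t); apply: eq_forallb => w; rewrite arrow_relabel.
  by congr (_ ==> ~~ _); apply: connect_perm; apply: arrow_relabel.
- rewrite -(forall_perm t); apply: eq_forallb => u.
  rewrite /good_vertex; congr [&& _, _ & _].
  + congr (_ <= _)%N.
    rewrite -[RHS](card_imset _ (@perm_inj _ l)); congr #|pred_of_set _|.
    apply/setP => h; rewrite -[h](permKV l) mem_imset; last exact: perm_inj.
    by rewrite !inE vtx_relabel (inj_eq perm_inj).
  + rewrite -(exists_perm l); apply: eq_existsb => h.
    by rewrite vtx_relabel (inj_eq perm_inj) outgoing_hleg_perm.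
  + rewrite -(exists_perm l); apply: eq_existsb => h.
    by rewrite vtx_relabel (inj_eq perm_inj) outgoing_hleg_perm.
Qed.

End RelabelTheory.

Section SplittingRelabel.
Variables (v e p q : nat) (t : 'S_v) (s : 'S_e).
Let l : {perm hleg e p q} := hleg_perm s 1 1.
Let l' : {perm hleg e.+1 p q} := hleg_perm (lift_perm ord0 ord0 s) 1 1.

Lemma lift_old h : l' (old h) = old (l h).
Proof.
case: h => [[j|i]|[j|i]] /=.
- by rewrite [l _]hleg_perm_src [LHS]hleg_perm_src lift_perm_lift.
- by rewrite [l _]hleg_perm_out [LHS]hleg_perm_out !perm1.
- by rewrite [l _]hleg_perm_tgt [LHS]hleg_perm_tgt lift_perm_lift.
- by rewrite [l _]hleg_perm_in [LHS]hleg_perm_in !perm1.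
Qed.

Lemma lift_src : l' (esrc ord0) = esrc ord0.
Proof. by rewrite hleg_perm_src lift_perm_id. Qed.

Lemma lift_tgt : l' (etgt ord0) = etgt ord0.
Proof. by rewrite hleg_perm_tgt lift_perm_id. Qed.

Lemma is_old_old (h : hleg e p q) : is_old (old h) = Some h. Proof. exact: oldK. Qed.

Lemma splitting_relabel (G : ribbon v e p q) a b :
  splitting (relabel t s 1 1 G) (l a) (l b) =
  relabel (lift_perm ord0 ord0 t) (lift_perm ord0 ord0 s) 1 1 (splitting G a b).
Proof.
rewrite /splitting /relabel /= -/l -/l'.
have -> : extend (cyc G ^ l)%g = (extend (cyc G) ^ l')%g.
  apply/permP => h; rewrite -[h](permKV l') permJ; move: ((l'^-1)%g h) => g.
  rewrite !extendE /extend_fun.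
  case: (is_oldP g) => [h' ->|->|->]; rewrite ?lift_old ?lift_src ?lift_tgt.
  - by rewrite !is_old_old permJ -lift_old.
  - by rewrite !is_old_src.
  - by rewrite !is_old_tgt.
set c := (extend _ * _ * _ * _)%g.
have -> : (extend (cyc G) ^ l' * tperm (esrc ord0) (old (l a)) *
           tperm (etgt ord0) (old (l b)) * tperm (esrc ord0) (etgt ord0))%g
          = (c ^ l')%g.
  by rewrite /c !conjMg !tpermJ !lift_old lift_src lift_tgt.
congr Ribbon; apply/ffunP => h; rewrite -[h](permKV l').
move: ((l'^-1)%g h) => g; rewrite !ffunE permK.
rewrite -{1}lift_src mem_porbitJ; case: ifP => _; first by rewrite lift_perm_id.
case: (is_oldP g) => [h' ->|->|->]; rewrite ?lift_old ?lift_src ?lift_tgt.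
- by rewrite !is_old_old /= permK lift_perm_lift.
- by rewrite !is_old_src /= permK lift_perm_lift.
- by rewrite !is_old_tgt /= permK lift_perm_lift.
Qed.

End SplittingRelabel.

Arguments relabel : simpl never.

Section RelationStable.
Variables (K : fieldType) (d : int) (p q : nat).

Lemma gen_relabel v e (t : 'S_v) (s : 'S_e) (G : ribbon v e p q) :
  lproj (@iso_rel K d p q) (gen K (relabel t s 1 1 G)) =
  lproj (@iso_rel K d p q)
    (or_sign K d t s (1 : 'S_p)%g (1 : 'S_q)%g *: gen K G).
Proof.
by apply/lquotP/lspan_in; exists v, e, t, s, G.
Qed.

Lemma graph_diff_gen v e (G : ribbon v e p q) : admissible G ->
  graph_diff (gen K G) =
  \sum_a \sum_(b | (b != a) && (vtx G b == vtx G a)) gen K (splitting G a b).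
Proof. by move=> aG; rewrite /gen insubT /graph_diff linextU. Qed.

Lemma gen_inadmissible v e (G : ribbon v e p q) : ~~ admissible G -> gen K G = 0.
Proof. by move=> nG; rewrite /gen insubN. Qed.

Lemma graph_diff_iso_rel x :
  @iso_rel K d p q x -> lspan (@iso_rel K d p q) (graph_diff x).
Proof.
case=> v [e [t [s [G ->]]]]; rewrite -lproj_eq0.
have [aG|nG] := boolP (admissible G); last first.
  by rewrite !gen_inadmissible ?admissible_relabel // scaler0 subrr !linear0.
rewrite linearB linearZ /= !graph_diff_gen ?admissible_relabel // linearB linearZ /=.
apply/eqP; rewrite subr_eq0; apply/eqP; pose l := hleg_perm s (1 : 'S_p)%g (1 : 'S_q)%g.
rewrite (reindex_inj (@perm_inj _ l)) !linear_sum.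
apply: eq_bigr => a _; rewrite (reindex_inj (@perm_inj _ l)) !linear_sum.
apply: eq_big => [b|b _]; first by rewrite !vtx_relabel !(inj_eq perm_inj).
rewrite splitting_relabel [LHS]gen_relabel linearZ /=; congr (_ *: _).
by rewrite /or_sign !odd_lift_perm.
Qed.

End RelationStable.

Section DgProperad.
Variables (K : fieldType) (d : int).

Definition hq_class p q : graph_space K p q -> PreCY K d p q := lproj _.

Definition PreCY_diff p q : PreCY K d p q -> PreCY K d p q :=
  lquot_map (@graph_diff_iso_rel K d p q).
HB.instance Definition _ p q := GRing.Linear.on (@PreCY_diff p q).

Definition PreCY_deg p q (n : int) : PreCY K d p q -> Prop :=
  lspan (fun x => exists2 G : hquiver p q, hq_degree d G = n & x = hq_class << G >>).

Definition graph_act p q (a : 'S_p) (b : 'S_q) :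
    graph_space K p q -> graph_space K p q :=
  linext (fun G : hquiver p q =>
    or_sign K d (1 : 'S_(tag G).1)%g (1 : 'S_(tag G).2)%g a b
      *: gen K (relabel 1 1 a b (hq_graph G))).

Definition graph_comp p1 q1 p2 q2 k (f : graph_space K (p1 + k) q1)
    (g : graph_space K p2 (k + q2)) : graph_space K (p1 + p2) (q1 + q2) :=
  linext (fun G1 : hquiver (p1 + k) q1 =>
    linext (fun G2 : hquiver p2 (k + q2) =>
      glue_sign p1 q1 (tag G2).1 (tag G2).2 p2 k K d
        *: gen K (gluing (hq_graph G1) (hq_graph G2))) g) f.

Definition subspaces := forall p q, PreCY K d p q -> Prop.

(* The action of the symmetric groups and the properadic compositions along   *)
(* k > 0 hairs are computed on representatives; up to these actions, every    *)
(* composition of two elements is of this form.                               *)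
Record properadic_ideal (J : subspaces) : Prop := {
  ideal0 p q : @J p q 0;
  idealP p q c (x y : PreCY K d p q) : J p q x -> J p q y -> J p q (c *: x + y);
  ideal_act p q (a : 'S_p) (b : 'S_q) (f : graph_space K p q) :
    J p q (hq_class f) -> J p q (hq_class (graph_act a b f));
  ideal_compl p1 q1 p2 q2 k (f : graph_space K (p1 + k) q1)
      (g : graph_space K p2 (k + q2)) :
    (0 < k)%N -> J _ _ (hq_class f) -> J _ _ (hq_class (graph_comp f g));
  ideal_compr p1 q1 p2 q2 k (f : graph_space K (p1 + k) q1)
      (g : graph_space K p2 (k + q2)) :
    (0 < k)%N -> J _ _ (hq_class g) -> J _ _ (hq_class (graph_comp f g)) }.

Definition diff_closed (J : subspaces) : Prop :=
  forall p q x, J p q x -> J p q (PreCY_diff x).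

(* The ideal generated by the graphs with a vertex of valency >= 4, and its   *)
(* differential closure.                                                      *)
Definition ideal_ge4 : subspaces := fun p q x =>
  forall J : subspaces, properadic_ideal J ->
    (forall p' q' (G : hquiver p' q'),
        has_valency_ge4 (hq_graph G) -> J p' q' (hq_class << G >>)) ->
    J p q x.

Definition ideal_ge4_hat : subspaces := fun p q x =>
  forall J : subspaces, properadic_ideal J -> diff_closed J ->
    (forall p' q' y, ideal_ge4 y -> J p' q' y) -> J p q x.

Lemma ideal_ge4_hat_diff p q (x : PreCY K d p q) :
  ideal_ge4_hat x -> lspan (@ideal_ge4_hat p q) (PreCY_diff x).
Proof.
move=> Ix; apply: lspan_in => J Jid Jd J4; exact/Jd/(Ix J).
Qed.

Definition BIB p q : lmodType K := lquot (@ideal_ge4_hat p q).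

Definition BIB_diff p q : BIB p q -> BIB p q :=
  lquot_map (@ideal_ge4_hat_diff p q).

HB.instance Definition _ p q := GRing.Linear.on (@BIB_diff p q).

Definition BIB_proj p q : PreCY K d p q -> BIB p q := lproj _.
HB.instance Definition _ p q := GRing.Linear.on (@BIB_proj p q).

Lemma PreCY_diff_class p q (f : graph_space K p q) :
  PreCY_diff (hq_class f) = hq_class (graph_diff f).
Proof. exact: lquot_mapE. Qed.

Lemma BIB_diff_proj p q (x : PreCY K d p q) :
  BIB_diff (BIB_proj x) = BIB_proj (PreCY_diff x).
Proof. exact: lquot_mapE. Qed.

Definition BIB_deg p q (n : int) (y : BIB p q) : Prop :=
  exists2 x, PreCY_deg n x & y = BIB_proj x.

End DgProperad.

(* Quasi-isomorphisms of complexes whose differentials have degree 1; degA n  *)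
(* and degB n are the subspaces of elements of degree n.  The two conditions  *)
(* say that H^n(f) is injective and surjective.                               *)
Definition quasi_isomorphism (K : fieldType) (A B : lmodType K)
    (degA : int -> A -> Prop) (dA : A -> A)
    (degB : int -> B -> Prop) (dB : B -> B) (f : A -> B) : Prop :=
  forall n : int,
    (forall x, degA n x -> dA x = 0 ->
       (exists2 y, degB (n - 1) y & f x = dB y) ->
       exists2 z, degA (n - 1) z & x = dA z) /\
    (forall y, degB n y -> dB y = 0 ->
       exists x, [/\ degA n x, dA x = 0 &
         exists2 z, degB (n - 1) z & y = f x + dB z]).

(* PreCY is the cobar construction on the Koszul dual of BIB, so that         *)
(* Koszulness of BIB means that the cobar resolution PreCY -> BIB is a        *)
(* quasi-isomorphism.                                                         *)
Definition BIB_koszul (K : fieldType) (d : int) : Prop :=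
  forall p q, (0 < p)%N -> (0 < q)%N ->
    quasi_isomorphism (@PreCY_deg K d p q) (@PreCY_diff K d p q)
      (@BIB_deg K d p q) (@BIB_diff K d p q) (@BIB_proj K d p q).

(* Main.v *)
Require Import Defs.
From mathcomp Require Import all_boot all_order all_algebra.
From HB Require Import structures.
From mathcomp Require Import all_fingroup generic_quotient monalg.

(* The complex with two in-hairs, two out-hairs and one loop has a cohomology *)
(* class one degree below the top.  It lives on the annulus with the hairs    *)
(* i0, o0 on one boundary and i1, o1 on the other, and is represented by a    *)
(* sum of 16 graphs with three vertices, one of valency 4: the 40 graphs in   *)
(* its differential cancel in pairs.  Graphs with a vertex of valency 4 are   *)
(* zero in BIB.  To see that the sum is not exact, let P be its first graph   *)
(*   (i0 o0 s0) (t0 s1 i1 s2) (t1 t2 o1)                                      *)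
(* and let P' be P with the edge 0 reversed.  Exchanging the two halves of    *)
(* the new edge matches the splittings of a graph that are isomorphic to P    *)
(* with those that are isomorphic to P': the new edge corresponds to the edge *)
(* 0, because the edges 1 and 2 are parallel, so that contracting one of them *)
(* makes a loop of the other one.  Hence the coefficient of P, minus (plus    *)
(* for d odd) that of P', vanishes on all boundaries, but is 1 on the sum.    *)

Set Implicit Arguments.
Unset Strict Implicit.
Unset Printing Implicit Defensive.

Import GRing.Theory.
Local Open Scope ring_scope.

(** If [BIB] were Koszul, [BIB_proj] would be injective on cohomology. This fails for two in-hairs
    and two out-hairs: [witness] is closed ([witness_closed]), maps to zero because each of its
    graphs has a vertex of valency 4 ([witness_ideal]), and is not a boundary ([witness_not_exact]).

    Non-exactness is detected by a linear functional. The differential sums over ordered pairs (a,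
    b) of half-legs at a vertex, and (b, a) yields the graph of (a, b) with its new edge reversed
    ([reverse0_splitting]). If edge 0 is the only edge of [P] that a splitting can have created
    ([splitting_new_edge]), the coefficients of [P] and of [reverse0 P] in a boundary therefore
    agree up to a sign depending on the parity of d. Their signed difference [cocycle] kills
    boundaries ([cocycle_diff]) and isomorphism relations ([cocycle_iso_rel]), but takes the value 1
    on [witness] ([cocycle_witness]).

    Closedness is a finite computation. Graphs become tables of numbers, their splittings are
    relabelled by transpositions with signs, and the resulting signed tables cancel in pairs
    ([diff_tableE], [cancels_sum]). Only the signs of the relabelling have to be proved correct, not
    that it yields a normal form. *)

Lemma ribbon_eq v e p q (G H : ribbon v e p q) :
  cyc G = cyc H -> vtx G =1 vtx H -> G = H.
Proof. by case: G H => c f [c' f'] /= -> /ffunP ->. Qed.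

(** * Relabellings as a group action with orientation signs *)

Section RelabelGroup.
Variables (v e p q : nat).
Implicit Types (G : ribbon v e p q) (t : 'S_v) (s : 'S_e).

Lemma hleg_permM s s' (a a' : 'S_p) (b b' : 'S_q) :
  (hleg_perm s a b * hleg_perm s' a' b')%g
  = hleg_perm (s * s')%g (a * a')%g (b * b')%g.
Proof. by rewrite !sum_permM. Qed.

Lemma hleg_perm1 : hleg_perm (1 : 'S_e) (1 : 'S_p) (1 : 'S_q) = 1%g.
Proof. by rewrite /hleg_perm !sum_perm1. Qed.

Lemma relabelM t t' s s' G :
  relabel t' s' 1 1 (relabel t s 1 1 G) = relabel (t * t')%g (s * s')%g 1 1 G.
Proof.
congr Ribbon; first by rewrite -conjgM hleg_permM !mulg1.
apply/ffunP => h; rewrite !ffunE permM; congr (t' (t (vtx G _))).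
by rewrite -permM -invMg hleg_permM !mulg1.
Qed.

Lemma relabel_inj t s : injective (@relabel v e p q t s 1 1).
Proof.
move=> G G' /(congr1 (relabel t^-1 s^-1 (1 : 'S_p)^-1 (1 : 'S_q)^-1)%g).
by rewrite !relabelK.
Qed.

Lemma or_signM (K : nzRingType) d t t' s s' :
  or_sign K d (t * t')%g (s * s')%g (1 : 'S_p)%g (1 : 'S_q)%g =
  or_sign K d t s (1 : 'S_p)%g (1 : 'S_q)%g
  * or_sign K d t' s' (1 : 'S_p)%g (1 : 'S_q)%g.
Proof.
by rewrite /or_sign !odd_permM !odd_perm1 !addbF; case: ifP; rewrite signr_addb.
Qed.

Lemma cyc_relabel t s G h :
  cyc (relabel t s 1 1 G) (hleg_perm s 1 1 h) = hleg_perm s 1 1 (cyc G h).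
Proof. by rewrite permJ. Qed.

(** A loop would be a directed cycle of length one. *)
Lemma loopless G j : admissible G -> vtx G (esrc j) != vtx G (etgt j).
Proof.
case/and4P=> _ _ /forallP/(_ (vtx G (esrc j)))/forallP/(_ (vtx G (etgt j))) + _.
move=> /implyP nc; apply/eqP => E; move: nc; rewrite -E connect0 => nc.
by have /nc: arrow G (vtx G (esrc j)) (vtx G (esrc j));
  first by apply/existsP; exists j; rewrite eqxx -E eqxx.
Qed.

End RelabelGroup.

(** * Coefficients at an isomorphism class *)

Section Coordinate.
Variables (K : fieldType) (d : int) (p q : nat).

(** Packing the sizes with the graph lets [P] be compared with graphs that have other numbers of
    vertices and edges. *)
Definition any_ribbon v e (G : ribbon v e p q) :
    {ve : nat * nat & ribbon ve.1 ve.2 p q} :=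
  @Tagged _ (v, e) (fun ve => ribbon ve.1 ve.2 p q) G.

Lemma any_ribbon_inj v e : injective (@any_ribbon v e).
Proof. by move=> G G' /eqP; rewrite eq_Tagged => /eqP. Qed.

Local Notation or_sgn t s := (or_sign K d t s (1 : 'S_p)%g (1 : 'S_q)%g).

(* The coefficient at the isomorphism class of P, times the number of         *)
(* automorphisms of P.                                                        *)
Definition coord v0 e0 (P : ribbon v0 e0 p q) v e (G : ribbon v e p q) : K :=
  \sum_(t : 'S_v0) \sum_(s : 'S_e0)
    or_sgn t s *+ (any_ribbon G == any_ribbon (relabel t s 1 1 P)).

Variables (v0 e0 : nat) (P : ribbon v0 e0 p q).

Lemma coord_tag v e (G : ribbon v e p q) : (v, e) != (v0, e0) -> coord P G = 0.
Proof.
move=> ne; apply: big1 => t _; apply: big1 => s _.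
by case: eqP => // /(congr1 tag)/= E; rewrite E eqxx in ne.
Qed.

Lemma coordE (G : ribbon v0 e0 p q) :
  coord P G = \sum_t \sum_s or_sgn t s *+ (G == relabel t s 1 1 P).
Proof.
apply: eq_bigr => t _; apply: eq_bigr => s _.
by rewrite (inj_eq (@any_ribbon_inj _ _)).
Qed.

Lemma coord_eq0 v e (G : ribbon v e p q) :
  (forall t s, any_ribbon G <> any_ribbon (relabel t s 1 1 P)) -> coord P G = 0.
Proof.
by move=> ne; apply: big1 => t _; apply: big1 => s _; case: eqP => [/ne|].
Qed.

(** Translation by (t, s) permutes the summands, and [or_sign] is multiplicative. *)
Lemma coord_relabel v e (t : 'S_v) (s : 'S_e) (G : ribbon v e p q) :
  coord P (relabel t s 1 1 G) = or_sgn t s * coord P G.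
Proof.
have [E|ne] := eqVneq (v, e) (v0, e0); last by rewrite !coord_tag ?mulr0.
case: E => Ev Ee; subst v e; rewrite !coordE.
rewrite (reindex_inj (mulIg t)) mulr_sumr; apply: eq_bigr => t' _.
rewrite (reindex_inj (mulIg s)) mulr_sumr; apply: eq_bigr => s' _.
rewrite -relabelM (inj_eq (@relabel_inj _ _ _ _ _ _)) or_signM mulrC.
by rewrite mulrnAr.
Qed.

(** Relabelling preserves admissibility, so [G] is no relabelling of [P]. This agrees with the value
    0 that [gen] takes on [G]. *)
Lemma coord_inadmissible v e (G : ribbon v e p q) :
  admissible P -> ~~ admissible G -> coord P G = 0.
Proof.
have [E|ne] := eqVneq (v, e) (v0, e0); last by rewrite coord_tag.
case: E => Ev Ee; subst v e => aP naG; apply: coord_eq0 => t s /any_ribbon_inj E.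
by rewrite E admissible_relabel aP in naG.
Qed.

Definition coordinate : graph_space K p q -> K^o :=
  linext (fun G : hquiver p q => coord P (hq_graph G) : K^o).
HB.instance Definition _ := GRing.Linear.on coordinate.

Lemma coordinate_gen v e (G : ribbon v e p q) :
  admissible P -> coordinate (gen K G) = coord P G.
Proof.
move=> aP; rewrite /gen; case: insubP => [G' aG EG|naG]; last first.
  by rewrite linear0 coord_inadmissible.
by rewrite /coordinate linextU /hq_graph /= EG.
Qed.

Lemma coordinate_iso_rel x : admissible P ->
  iso_rel d x -> coordinate x = 0.
Proof.
move=> aP [v [e [t [s [G ->]]]]].
by rewrite linearB linearZ /= !coordinate_gen // coord_relabel subrr.
Qed.

End Coordinate.

(** * Reversing the edge created by a splitting *)

Section Reversal.
Variables (v e p q : nat).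
Local Notation src0 := (esrc ord0 : hleg e.+1 p q).
Local Notation tgt0 := (etgt ord0 : hleg e.+1 p q).
Local Notation flip0 := (tperm src0 tgt0).

Definition reverse0 w (P : ribbon w e.+1 p q) : ribbon w e.+1 p q :=
  Ribbon (cyc P ^ flip0)%g [ffun h => vtx P (flip0 h)].

Lemma reverse0K w : involutive (@reverse0 w).
Proof.
case=> c f; rewrite /reverse0 /= -conjgM tperm2 conjg1; congr Ribbon.
by apply/ffunP => h; rewrite !ffunE tpermK.
Qed.

Lemma reverse0_relabel w (t : 'S_w) (s : 'S_e.+1) (P : ribbon w e.+1 p q) :
  s ord0 = ord0 ->
  reverse0 (relabel t s 1 1 P) = relabel t s 1 1 (reverse0 P).
Proof.
move=> s0; set l := hleg_perm s (1 : 'S_p)%g (1 : 'S_q)%g.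
have lf : (flip0 * l = l * flip0)%g.
  by rewrite conjgC tpermJ /l hleg_perm_src hleg_perm_tgt s0.
rewrite /reverse0 /relabel /= -/l -!conjgM lf; congr Ribbon.
apply/ffunP => h; rewrite !ffunE; congr (t (vtx P _)).
have lfx x : flip0 (l x) = l (flip0 x) by rewrite -!permM lf.
by apply: (@perm_inj _ l); rewrite -lfx !permKV.
Qed.

Lemma vtx_splitting (G : ribbon v e p q) a b h :
  vtx (splitting G a b) h =
  if h \in porbit (cyc (splitting G a b)) src0 then ord0
  else lift ord0 (vtx G (odflt b (is_old h))).
Proof. by rewrite ffunE. Qed.

Variables (G : ribbon v e p q) (a b : hleg e p q).
Hypotheses (adG : admissible G) (ab : b != a) (vab : vtx G b = vtx G a).

Local Notation R := (splitting G a b).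
Local Notation fiber h := (vtx G (odflt b (is_old h))).

Lemma vtx_cyc h : vtx G (cyc G h) = vtx G h.
Proof.
case/and4P: adG => /forallP/(_ h)/forallP/(_ (cyc G h))/eqP E _ _ _.
by apply/esym/eqP; rewrite E -{1}[cyc G]expg1 mem_porbit.
Qed.

(** The fibre is the vertex of [G] to which a half-leg belongs once the new edge is contracted. The
    transpositions in [splitting] only exchange half-legs over the split vertex, so they preserve
    it. *)
Lemma fiber_cyc h : fiber (cyc R h) = fiber h.
Proof.
have tp x y g : fiber x = fiber y -> fiber (tperm x y g) = fiber g.
  by move=> E; case: tpermP => [->|->|] //.
rewrite !permM tp ?is_old_src ?is_old_tgt //=.
rewrite tp ?is_old_old ?is_old_tgt // tp ?is_old_old ?is_old_src //.
rewrite extendE /extend_fun; case: (is_oldP h) => [h' _|->|->].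
- by rewrite is_old_old /= vtx_cyc.
- by rewrite is_old_src.
- by rewrite is_old_tgt.
Qed.

Lemma fiber_porbit x h : h \in porbit (cyc R) x -> fiber h = fiber x.
Proof.
case/porbitP=> n ->; elim: n => [|n IH]; first by rewrite expg0 perm1.
by rewrite expgSr permM fiber_cyc.
Qed.

Lemma vtx_splitting_fiber h h' : vtx R h = vtx R h' -> fiber h = fiber h'.
Proof.
rewrite !vtx_splitting.
case: ifP => [/fiber_porbit->|_]; case: ifP => [/fiber_porbit->|_] //.
by move/lift_inj.
Qed.

(** Conjugation exchanges the roles of the two new half-edges; the two inserting transpositions then
    have to be reordered, and they commute because a and b differ. *)
Lemma cyc_splittingC : cyc (splitting G b a) = (cyc R ^ flip0)%g.
Proof.
have old_srcF h : (old h == src0) = false.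
  by apply/eqP => /(congr1 (@is_old _ _ _)); rewrite is_old_old is_old_src.
have old_tgtF h : (old h == tgt0) = false.
  by apply/eqP => /(congr1 (@is_old _ _ _)); rewrite is_old_old is_old_tgt.
have src_oldF h : (src0 == old h) = false by rewrite eq_sym.
have tgt_oldF h : (tgt0 == old h) = false by rewrite eq_sym.
have Ef c : (extend c ^ flip0 = extend c)%g.
  apply/permP => h; rewrite -{1}[h](tpermK src0 tgt0) permJ !extendE /extend_fun.
  case: (is_oldP h) => [h' ->|->|->].
  - by rewrite !tpermD ?is_old_old ?src_oldF ?tgt_oldF.
  - by rewrite tpermL is_old_tgt tpermR.
  - by rewrite tpermR is_old_src tpermL.
rewrite /= !conjMg Ef !tpermJ tpermL tpermR.
rewrite !(tpermD (z := old _)) ?src_oldF ?tgt_oldF //.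
rewrite (tpermC tgt0 src0); congr (_ * _)%g; rewrite -!mulgA; congr (_ * _)%g.
apply/esym; rewrite conjgC tpermJ !tpermD ?old_srcF ?old_tgtF ?src_oldF ?tgt_oldF //.
by rewrite (inj_eq (@old_inj _ _ _)).
Qed.

(** Both splittings cut the vertex into the same two pieces. The label 0 always goes to the source
    of the new edge, so reversing that edge also exchanges two vertex labels; this transposition is
    the origin of the sign in [cocycle]. *)
Lemma reverse0_splitting (adR : admissible R) :
  splitting G b a
  = relabel (tperm ord0 (lift ord0 (vtx G a))) 1 1 1 (reverse0 R).
Proof.
have vacR x y : (vtx R x == vtx R y) = (y \in porbit (cyc R) x).
  by case/and4P: adR => /forallP/(_ x)/forallP/(_ y)/eqP.
apply: ribbon_eq => [|h]; first by rewrite /= hleg_perm1 conjg1 -cyc_splittingC.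
rewrite vtx_splitting cyc_splittingC /relabel hleg_perm1.
rewrite [RHS]ffunE invg1 perm1 [in RHS]ffunE.
have orb g : (flip0 g \in porbit (cyc R ^ flip0)%g src0) = (g \in porbit (cyc R) tgt0).
  by rewrite -[RHS](mem_porbitJ _ flip0) tpermR.
rewrite -[h](tpermK src0 tgt0); move: (flip0 h) => g; rewrite orb tpermK.
have Eg : vtx G (odflt a (is_old (flip0 g))) = fiber g.
  case: tpermP => [->|->|]; rewrite ?is_old_src ?is_old_tgt //= => ns nt.
  by case: (is_old g).
rewrite Eg -vacR.
have Rs : vtx R src0 = ord0 by rewrite vtx_splitting porbit_id.
have Rt : vtx R tgt0 = lift ord0 (vtx G a).
  have := loopless ord0 adR; rewrite Rs !vtx_splitting is_old_tgt vab.
  by case: ifP.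
(* Three cases: [g] at the source of the new edge, at its target, or at a vertex that was not
   split. *)
rewrite Rt vtx_splitting; have [gs|gs] := boolP (g \in porbit (cyc R) src0).
  by rewrite (fiber_porbit gs) is_old_src /= vab tpermL.
case: eqP => [<-|/eqP ne]; first by rewrite tpermR.
by rewrite tpermD // neq_lift.
Qed.

End Reversal.

Lemma linear_malg_eq0 (K : nzRingType) (T : choiceType) (V : lmodType K)
    (h : {linear {malg K[T]} -> V}) :
  (forall t, h << t >> = 0) -> forall f, h f = 0.
Proof.
move=> h0 f; rewrite [f]monalgE linear_sum big1 // => t _.
have -> : << f@_t *g t >> = f@_t *: << t >> :> {malg K[T]}.
  by apply/malgP => t'; rewrite mcoeffZ !mcoeffU mulr_natr.
by rewrite linearZ /= h0 scaler0.
Qed.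

(** * A functional that vanishes on boundaries *)

Section ReversalCocycle.
Variables (p q : nat).

Definition parallel_edges v e (H : ribbon v e.+1 p q) := forall j, j != ord0 ->
  exists2 k, k != j &
    vtx H (esrc k) = vtx H (esrc j) /\ vtx H (etgt k) = vtx H (etgt j).

(** Suppose that the new edge corresponds to an edge j of [H] other than 0. Contracting it would
    turn the edge parallel to j into a loop of [G], contrary to [loopless]. *)
Lemma splitting_new_edge v e (G : ribbon v e p q) a b H (t : 'S_v.+1) (s : 'S_e.+1) :
  admissible G -> vtx G b = vtx G a -> parallel_edges H ->
  splitting G a b = relabel t s 1 1 H -> s ord0 = ord0.
Proof.
move=> adG vab par E; apply/eqP/negPn/negP => s0.
pose j := (s^-1)%g ord0; have sj : s j = ord0 by rewrite permKV.
have /par[k kj [Es Et]] : j != ord0 by apply: contraNneq s0 => j0; rewrite -{1}j0 sj.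
have : s k != ord0 by rewrite -sj (inj_eq perm_inj).
case: (unliftP ord0 (s k)) => [i Ei _|Ei /eqP[]//].
have vE x y : vtx H x = vtx H y ->
    vtx (splitting G a b) (hleg_perm s 1 1 x) = vtx (splitting G a b) (hleg_perm s 1 1 y).
  by rewrite E !vtx_relabel => ->.
have := vtx_splitting_fiber adG vab (vE _ _ Es).
have := vtx_splitting_fiber adG vab (vE _ _ Et).
rewrite !hleg_perm_src !hleg_perm_tgt sj Ei is_old_src is_old_tgt /= !liftK /=.
by move=> Et' Es'; have := loopless i adG; rewrite Et' Es' eqxx.
Qed.

Lemma splitting_swap v e (G : ribbon v e p q) a b H (t : 'S_v.+1) (s : 'S_e.+1) :
  admissible G -> b != a -> vtx G b = vtx G a ->
  admissible H -> parallel_edges H ->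
  splitting G a b = relabel t s 1 1 H ->
  splitting G b a =
    relabel (t * tperm ord0 (lift ord0 (vtx G a)))%g s 1 1 (reverse0 H).
Proof.
move=> adG ab vab adH par E; have s0 := splitting_new_edge adG vab par E.
rewrite reverse0_splitting // E ?admissible_relabel //.
by rewrite reverse0_relabel // relabelM mulg1.
Qed.

Variables (K : fieldType) (d : int).

(** The relabelling (t, s) contributes on the left exactly when (t * tau, s) contributes on the
    right. The transposition [tau] of vertices costs a sign for d odd only. *)
Lemma coord_splitting_swap v0 e0 (P : ribbon v0.+1 e0.+1 p q)
    v e (G : ribbon v e p q) a b :
  admissible P -> admissible (reverse0 P) ->
  parallel_edges P -> parallel_edges (reverse0 P) ->
  admissible G -> b != a -> vtx G b = vtx G a ->
  coord K d P (splitting G a b) =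
    (if odd `|d|%N then -1 else 1) * coord K d (reverse0 P) (splitting G b a).
Proof.
move=> adP adP' par par' adG ab vab.
have [[Ev Ee]|ne] := eqVneq (v, e) (v0, e0); last first.
  have ne' : (v.+1, e.+1) != (v0.+1, e0.+1) by rewrite xpair_eqE !eqSS -xpair_eqE.
  by rewrite !coord_tag ?mulr0.
subst v e; pose tau := tperm ord0 (lift ord0 (vtx G a)).
rewrite !coordE [in RHS](reindex_inj (mulIg tau)) mulr_sumr; apply: eq_bigr => t _.
rewrite mulr_sumr; apply: eq_bigr => s _.
have -> : or_sign K d (t * tau)%g s (1 : 'S_p)%g (1 : 'S_q)%g =
    or_sign K d t s (1 : 'S_p)%g (1 : 'S_q)%g * (if odd `|d|%N then -1 else 1).
  rewrite -{1}[s]mulg1 or_signM; congr (_ * _).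
  by rewrite /or_sign !odd_perm1 odd_tperm neq_lift; case: ifP.
have -> : (splitting G b a == relabel (t * tau) s 1 1 (reverse0 P))
        = (splitting G a b == relabel t s 1 1 P).
  apply/eqP/eqP => [/splitting_swap|/splitting_swap -> //].
  by move=> -> //; rewrite 1?eq_sym // vab reverse0K -mulgA tperm2 mulg1.
rewrite mulrnAr; congr (_ *+ _).
by case: ifP => _; rewrite ?mulN1r ?mulrN1 ?opprK ?mul1r ?mulr1.
Qed.

Definition cocycle v e (P : ribbon v e.+1 p q) : graph_space K p q -> K^o :=
  fun x => coordinate d P x
           - (if odd `|d|%N then -1 else 1) *: coordinate d (reverse0 P) x.

Lemma cocycle_is_linear v e (P : ribbon v e.+1 p q) : linear (cocycle P).
Proof.
move=> c x y; rewrite /cocycle !(linearP (coordinate d _)).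
rewrite scalerDr scalerA mulrC -scalerA.
by rewrite opprD addrACA -scalerBr.
Qed.
HB.instance Definition _ v e (P : ribbon v e.+1 p q) :=
  GRing.isLinear.Build K (graph_space K p q) K^o _ (cocycle P)
    (cocycle_is_linear P).

Lemma cocycle_diff v e (P : ribbon v.+1 e.+1 p q) f :
  admissible P -> admissible (reverse0 P) ->
  parallel_edges P -> parallel_edges (reverse0 P) ->
  cocycle P (graph_diff f) = 0.
Proof.
move=> adP adP' par par'; pose eps : K := if odd `|d|%N then -1 else 1.
suff gen0 G : cocycle P (graph_diff << G >>) = 0.
  exact: (linear_malg_eq0 (h := cocycle P \o @graph_diff K p q)).
have adG : admissible (hq_graph G) := valP (tagged G).
have Ediff (H : ribbon v.+1 e.+1 p q) : admissible H ->
    coordinate d H (graph_diff << G >>) =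
    \sum_a \sum_(b | (b != a) && (vtx (hq_graph G) b == vtx (hq_graph G) a))
      coord K d H (splitting (hq_graph G) a b).
  move=> adH; rewrite /graph_diff linextU linear_sum; apply: eq_bigr => a _.
  by rewrite linear_sum; apply: eq_bigr => b _; exact: coordinate_gen.
apply/eqP; rewrite subr_eq0 !Ediff // scaler_sumr; apply/eqP.
transitivity (\sum_a \sum_(b | (b != a) && (vtx (hq_graph G) b == vtx (hq_graph G) a))
      eps * coord K d (reverse0 P) (splitting (hq_graph G) b a)).
  apply: eq_bigr => a _; apply: eq_bigr => b /andP[ab /eqP vab].
  exact: coord_splitting_swap.
(* The sum runs over all ordered pairs, so a and b may be renamed into each other. *)
rewrite (exchange_big_dep predT) //=; apply: eq_bigr => a _.
rewrite scaler_sumr; apply: eq_bigl => b.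
by rewrite eq_sym [X in _ && X]eq_sym.
Qed.

End ReversalCocycle.

Lemma cocycle_iso_rel (K : fieldType) d p q v e (P : ribbon v e.+1 p q)
    (x : graph_space K p q) :
  admissible P -> admissible (reverse0 P) ->
  lspan (iso_rel d (p := p) (q := q)) x -> cocycle d P x = 0.
Proof.
move=> adP adP'; elim=> [|c y z Ry _ IH]; first by rewrite linear0.
have -> : cocycle d P (c *: y + z) = c *: cocycle d P y + cocycle d P z.
  exact: linearP.
rewrite IH addr0 /cocycle !(coordinate_iso_rel _ Ry) //.
by rewrite scaler0 subrr scaler0.
Qed.

Definition hquiver_of v e p q (G : ribbon v e p q) (adG : admissible G) : hquiver p q :=
  to_hquiver (exist _ G adG : quiver v e p q).

Lemma gen_admissible (K : fieldType) v e p q (G : ribbon v e p q) (adG : admissible G) :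
  gen K G = << hquiver_of adG >>.
Proof. by rewrite /gen insubT. Qed.

(* Half-legs whose labels are plain numbers: on these, unlike on ordinals and *)
(* permutations, the splittings of a graph can be computed by reduction.      *)
Definition leg : Type := ((nat + nat) + (nat + nat))%type.

Definition leg_of e p q (h : hleg e p q) : leg :=
  match h with
  | inl (inl j) => inl (inl (j : nat)) | inl (inr i) => inl (inr (i : nat))
  | inr (inl j) => inr (inl (j : nat)) | inr (inr i) => inr (inr (i : nat))
  end.

Lemma leg_of_inj e p q : injective (@leg_of e p q).
Proof. by move=> [[j|i]|[j|i]] [[j'|i']|[j'|i']] // [] /val_inj->. Qed.

(** The order is that of [enum] on [hleg e p q], which turns sums and quantifiers over half-legs
    into operations on lists. *)
Definition legs e p q : seq leg :=
  [seq inl x | x <- [seq inl j | j <- iota 0 e] ++ [seq inr i | i <- iota 0 p]]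
  ++ [seq inr x | x <- [seq inl j | j <- iota 0 e] ++ [seq inr i | i <- iota 0 q]].

Lemma enum_sum (A B : finType) :
  enum {: A + B} = [seq inl a | a <- enum A] ++ [seq inr b | b <- enum B].
Proof. by rewrite !enumT [in LHS]unlock. Qed.

Lemma legsE e p q : legs e p q = [seq leg_of h | h <- enum {: hleg e p q}].
Proof.
rewrite /legs !enum_sum !map_cat -!map_comp -!val_enum_ord -!map_comp.
by rewrite -!catA.
Qed.

Lemma mem_legs e p q (h : hleg e p q) : leg_of h \in legs e p q.
Proof. by rewrite legsE map_f ?mem_enum. Qed.

Definition swap (T : eqType) (a b x : T) : T :=
  if x == a then b else if x == b then a else x.

Lemma swapE (A : finType) (B : eqType) (f : A -> B) (a b x : A) :
  injective f -> f (tperm a b x) = swap (f a) (f b) (f x).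
Proof.
move=> fI; rewrite /swap !(inj_eq fI).
case: tpermP => [->|->|/eqP/negbTE-> /eqP/negbTE-> //]; rewrite ?eqxx //.
by case: eqP => [->|].
Qed.

(** A trajectory of any sufficient length replaces the cardinal of the orbit, which does not
    compute. *)
Lemma porbit_traject (A : finType) (s : {perm A}) x y n : (#|A| <= n)%N ->
  (y \in porbit s x) = (y \in traject s x n).
Proof.
move=> le; apply/idP/trajectP => [|[i _ ->]]; last by rewrite -permX mem_porbit.
rewrite porbit_traject => /trajectP[i lti ->]; exists i => //.
by apply: leq_trans lti (leq_trans (max_card _) le).
Qed.

(** * Ribbon graphs, their splittings and transpositions as tables *)

Section Tables.
Variables p q : nat.

(* A ribbon graph as a table: the entry of a half-leg is the next half-leg    *)
(* around its vertex, together with the label of this vertex.                 *)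
Definition table v e (G : ribbon v e p q) : seq (leg * nat) :=
  [seq (leg_of (cyc G h), vtx G h : nat) | h <- enum {: hleg e p q}].

Definition tabulate e (f : leg -> leg * nat) : seq (leg * nat) :=
  [seq f l | l <- legs e p q].

Definition look e (T : seq (leg * nat)) (l : leg) : leg * nat :=
  nth (l, 0%N) T (index l (legs e p q)).
Definition next e T l := (look e T l).1.
Definition vlabel e T l := (look e T l).2.

Section OneGraph.
Variables (v e : nat) (G : ribbon v e p q).

Lemma lookE h : look e (table G) (leg_of h) = (leg_of (cyc G h), vtx G h : nat).
Proof.
rewrite /look legsE index_map; last exact: leg_of_inj.
by rewrite (nth_map h) ?index_mem ?mem_enum // nth_index ?mem_enum.
Qed.

Lemma nextE h : next e (table G) (leg_of h) = leg_of (cyc G h).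
Proof. by rewrite /next lookE. Qed.

Lemma vlabelE h : vlabel e (table G) (leg_of h) = vtx G h.
Proof. by rewrite /vlabel lookE. Qed.

Lemma tabulateE f :
  (forall h, f (leg_of h) = (leg_of (cyc G h), vtx G h : nat)) ->
  tabulate e f = table G.
Proof. by move=> Ef; rewrite /tabulate legsE -map_comp; apply: eq_map. Qed.

Lemma traject_next h n :
  traject (next e (table G)) (leg_of h) n = [seq leg_of h' | h' <- traject (cyc G) h n].
Proof. by elim: n h => //= n IH h; rewrite nextE IH. Qed.

Lemma all_legs (P : pred leg) :
  all P (legs e p q) = [forall h : hleg e p q, P (leg_of h)].
Proof.
rewrite legsE all_map; apply/allP/forallP => [h x|h x _]; last exact: h.
by apply: h; rewrite mem_enum.
Qed.

Lemma has_legs (P : pred leg) :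
  has P (legs e p q) = [exists h : hleg e p q, P (leg_of h)].
Proof.
rewrite legsE has_map; apply/hasP/existsP => [[h _]|[h]]; exists h => //.
by rewrite mem_enum.
Qed.

Lemma all_labels (P : pred nat) : all P (iota 0 v) = [forall u : 'I_v, P u].
Proof.
rewrite -val_enum_ord all_map; apply/allP/forallP => [h x|h x _]; last exact: h.
by apply: h; rewrite mem_enum.
Qed.

End OneGraph.

Lemma table_inj v e : injective (@table v e).
Proof.
move=> G H E; have EL (h : hleg e p q) :
    look e (table G) (leg_of h) = look e (table H) (leg_of h).
  by rewrite E.
apply: ribbon_eq => [|h]; [apply/permP => h|]; move: (EL h); rewrite !lookE.
  by case=> /leg_of_inj.
by case=> _ /val_inj.
Qed.

Definition old_leg (l : leg) : leg :=
  match l with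
  | inl (inl j) => inl (inl j.+1) | inr (inl j) => inr (inl j.+1) | _ => l
  end.

Definition is_old_leg (l : leg) : option leg :=
  match l with
  | inl (inl j) => if j is j'.+1 then Some (inl (inl j')) else None
  | inr (inl j) => if j is j'.+1 then Some (inr (inl j')) else None
  | _ => Some l
  end.

Definition src0 : leg := inl (inl 0%N).
Definition tgt0 : leg := inr (inl 0%N).

Lemma leg_of_old e (h : hleg e p q) : leg_of (old h) = old_leg (leg_of h).
Proof. by case: h => [[j|i]|[j|i]]. Qed.

Lemma is_old_legE e (h : hleg e.+1 p q) :
  is_old_leg (leg_of h) = omap (@leg_of e p q) (is_old h).
Proof.
case: (is_oldP h) => [h' ->|->|->] //; rewrite leg_of_old.
by case: h' => [[j|i]|[j|i]].
Qed.

(** Permutations compose from left to right, so the factors in [splitting] appear here from the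
    inside out. *)
Definition split_next e (T : seq (leg * nat)) (a b l : leg) : leg :=
  swap src0 tgt0 (swap tgt0 (old_leg b) (swap src0 (old_leg a)
    (if is_old_leg l is Some l' then old_leg (next e T l') else l))).

Definition split_table e (T : seq (leg * nat)) (a b : leg) : seq (leg * nat) :=
  let orb := traject (split_next e T a b) src0 (size (legs e.+1 p q)) in
  tabulate e.+1 (fun l => (split_next e T a b l,
    if l \in orb then 0%N else (vlabel e T (odflt b (is_old_leg l))).+1)).

Lemma size_legs e : size (legs e p q) = #|{: hleg e p q}|.
Proof. by rewrite legsE size_map cardE. Qed.

Lemma table_splitting v e (G : ribbon v e p q) a b :
  table (splitting G a b) = split_table e (table G) (leg_of a) (leg_of b).
Proof.
rewrite /split_table; set c := split_next e _ _ _.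
have cE (h : hleg e.+1 p q) : c (leg_of h) = leg_of (cyc (splitting G a b) h).
  rewrite /= !permM !(swapE _ _ _ (@leg_of_inj _ _ _)) !leg_of_old.
  rewrite /c /split_next is_old_legE.
  rewrite extendE /extend_fun; case: (is_old h) => //= h'.
  by rewrite nextE leg_of_old.
have trE n (h : hleg e.+1 p q) : traject c (leg_of h) n =
    [seq leg_of h' | h' <- traject (cyc (splitting G a b)) h n].
  by elim: n h => //= n IH h; rewrite cE IH.
apply/esym/tabulateE => h; rewrite cE vtx_splitting; congr (_, _).
rewrite (_ : src0 = leg_of (esrc ord0 : hleg e.+1 p q)) // trE.
rewrite (mem_map (@leg_of_inj _ _ _)) size_legs -porbit_traject //.
case: ifP => // _; rewrite is_old_legE /=.
by case: (is_old h) => [h'|] /=; rewrite vlabelE.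
Qed.

Definition relabel_leg (f : nat -> nat) (l : leg) : leg :=
  match l with
  | inl (inl j) => inl (inl (f j)) | inr (inl j) => inr (inl (f j)) | _ => l
  end.

Definition swap_edges e i j (T : seq (leg * nat)) : seq (leg * nat) :=
  let s := relabel_leg (swap i j) in
  tabulate e (fun l => (s (next e T (s l)), vlabel e T (s l))).

Definition swap_vertices i j (T : seq (leg * nat)) : seq (leg * nat) :=
  [seq (r.1, swap i j r.2) | r <- T].

Lemma leg_of_tperm e (i j : 'I_e) (h : hleg e p q) :
  leg_of (hleg_perm (tperm i j) 1 1 h) =
  relabel_leg (swap (i : nat) (j : nat)) (leg_of h).
Proof.
case: h => [[k|k]|[k|k]].
- by rewrite hleg_perm_src /= (swapE _ _ _ val_inj).
- by rewrite hleg_perm_out perm1.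
- by rewrite hleg_perm_tgt /= (swapE _ _ _ val_inj).
- by rewrite hleg_perm_in perm1.
Qed.

Lemma table_swap_edges v e (G : ribbon v e p q) (i j : 'I_e) :
  table (relabel 1 (tperm i j) 1 1 G) = swap_edges e i j (table G).
Proof.
pose l := hleg_perm (tperm i j) (1 : 'S_p) (1 : 'S_q).
have ll h : l (l h) = h by rewrite -permM hleg_permM tperm2 !mulg1 hleg_perm1 perm1.
apply/esym/tabulateE => h; rewrite -!leg_of_tperm nextE vlabelE -/l.
rewrite -leg_of_tperm -/l -{3 4}[h]ll; congr (_, _).
  by rewrite cyc_relabel.
by rewrite vtx_relabel perm1.
Qed.

Lemma table_swap_vertices v e (G : ribbon v e p q) (i j : 'I_v) :
  table (relabel (tperm i j) 1 1 1 G) = swap_vertices i j (table G).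
Proof.
rewrite /swap_vertices -map_comp; apply: eq_map => h /=.
rewrite -(swapE _ _ _ val_inj).
by rewrite ffunE hleg_perm1 conjg1 invg1 perm1.
Qed.

End Tables.

(** * Deciding admissibility on tables *)

Fixpoint walk (E : seq (nat * nat)) n u w : bool :=
  if u == w then true else
  if n is n'.+1 then has (fun x => if x.1 == u then walk E n' x.2 w else false) E
  else false.

(** Fuel [v] suffices, since every path shortens to one without repeated vertices. *)
Lemma connect_walk v (r : rel 'I_v) (E : seq ('I_v * 'I_v)) u w :
  (forall x y, r x y = ((x, y) \in E)) ->
  connect r u w = walk [seq (val x.1, val x.2) | x <- E] v (val u) (val w).
Proof.
move=> rE; apply/idP/idP.
  have short_walk n s x : path r x s -> (size s <= n)%N ->
      walk [seq (val x.1, val x.2) | x <- E] n (val x) (val (last x s)).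
    elim: n s x => [|n IH] [|y s] x //=; rewrite ?eqxx //.
    rewrite rE => /andP[xy /IH ps] le; case: ifP => // _; rewrite has_map.
    by apply/hasP; exists (x, y) => //=; rewrite eqxx ps.
  case/connectP=> s /shortenP[s' ps us _] ->; apply: short_walk => //.
  by have := max_card (mem (u :: s')); rewrite (card_uniqP us) card_ord; apply: ltnW.
have walk_connect n x : walk [seq (val x.1, val x.2) | x <- E] n (val x) (val w) ->
    connect r x w; last exact: walk_connect.
elim: n x => [|n IH] x /=.
  by case: ifP => // /eqP/val_inj-> _; exact: connect0.
case: ifP => [/eqP/val_inj-> _|_]; first exact: connect0.
rewrite has_map => /hasP[[y z] /=]; rewrite -rE => ryz.
by case: eqP => // /val_inj <- /IH; apply/connect_trans/connect1.
Qed.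

Section Admissible.
Variables (p q v e : nat).

Definition table_arrows (T : seq (leg * nat)) : seq (nat * nat) :=
  [seq (vlabel p q e T (inl (inl j)), vlabel p q e T (inr (inl j))) | j <- iota 0 e].

Definition table_good_vertex (T : seq (leg * nat)) u : bool :=
  let here := [seq l <- legs e p q | vlabel p q e T l == u] in
  (3 <= size here)%N && has (fun l => if l is inl _ then false else true) here
  && has (fun l => if l is inl _ then true else false) here.

(** The vertex conditions guard the rest by a conditional, so that call-by-value evaluation skips
    the searches when some vertex is bad. *)
Definition table_admissible (T : seq (leg * nat)) : bool :=
  let A := table_arrows T in
  let A' := A ++ [seq (x.2, x.1) | x <- A] in
  let L := legs e p q in
  if all (table_good_vertex T) (iota 0 v) then
    [&& all (fun x => let o := traject (next p q e T) x (size L) in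
          all (fun y => (vlabel p q e T x == vlabel p q e T y) == (y \in o)) L) L,
        (0 < v)%N && all (fun u => all (walk A' v u) (iota 0 v)) (iota 0 v) &
        all (fun u => all (fun w => ((u, w) \in A) ==> ~~ walk A v w u)
                          (iota 0 v)) (iota 0 v)]
  else false.

Definition table_valency T u := size [seq l <- legs e p q | vlabel p q e T l == u].

Variable G : ribbon v e p q.

Lemma table_valencyE (u : 'I_v) :
  table_valency (table G) u = #|[set h | vtx G h == u]|.
Proof.
rewrite /table_valency legsE filter_map size_map cardsE cardE /enum_mem -!enumT.
rewrite -filter_predI; congr size; apply: eq_in_filter => h _ /=.
by rewrite vlabelE !inE andbT.
Qed.

Lemma has_here (P : pred leg) (u : 'I_v) :
  has P [seq l <- legs e p q | vlabel p q e (table G) l == u]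
  = [exists h, (vtx G h == u) && P (leg_of h)].
Proof.
rewrite has_filter -filter_predI -has_filter has_legs; apply: eq_existsb => h /=.
by rewrite vlabelE andbC.
Qed.

Lemma admissible_table : admissible G = table_admissible (table G).
Proof.
pose A := [seq (vtx G (esrc j), vtx G (etgt j)) | j <- enum 'I_e].
have EA : table_arrows (table G) = [seq (val x.1, val x.2) | x <- A].
  rewrite /table_arrows -val_enum_ord -!map_comp; apply: eq_map => j /=.
  by rewrite -(vlabelE G (esrc j)) -(vlabelE G (etgt j)).
have arrE x y : arrow G x y = ((x, y) \in A).
  apply/existsP/mapP => [[j /andP[/eqP <- /eqP <-]]|[j _ [-> ->]]]; exists j => //.
    by rewrite mem_enum.
  by rewrite !eqxx.
have adjE x y : adjacent G x y = ((x, y) \in A ++ [seq (z.2, z.1) | z <- A]).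
  rewrite mem_cat /adjacent !arrE; congr (_ || _).
  apply/idP/mapP => [yx|[[a b] ab [-> ->]]] //; by exists (y, x).
rewrite /table_admissible !EA all_labels.
have -> : [forall u : 'I_v, table_good_vertex (table G) u] = [forall u, good_vertex G u].
  apply: eq_forallb => u; rewrite /table_good_vertex !has_here.
  rewrite -/(table_valency _ _) table_valencyE -andbA /good_vertex.
  by congr [&& _, _ & _]; apply: eq_existsb => -[[h|h]|[h|h]].
rewrite /admissible; case: [forall u, good_vertex G u]; last by rewrite !andbF.
rewrite andbT; congr [&& _, _ & _].
- rewrite all_legs; apply: eq_forallb => x; rewrite all_legs; apply: eq_forallb => y.
  rewrite !vlabelE traject_next (mem_map (@leg_of_inj _ _ _)) size_legs.
  by rewrite -porbit_traject.
- congr (_ && _); rewrite all_labels; apply: eq_forallb => u.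
  rewrite all_labels; apply: eq_forallb => w; rewrite (connect_walk _ _ adjE).
  by rewrite map_cat -!map_comp.
- rewrite all_labels; apply: eq_forallb => u; rewrite all_labels.
  apply: eq_forallb => w; rewrite (connect_walk _ _ arrE) arrE; congr (_ ==> _).
  apply/esym/(mem_map (f := fun x : 'I_v * 'I_v => (val x.1, val x.2)) _ A (u, w)).
  by move=> [a b] [a' b'] [/val_inj-> /val_inj->].
Qed.

End Admissible.

Lemma foldl_preserves (A B : Type) (P : A -> Prop) (f : A -> B -> A) (s : seq B) x :
  (forall y b, P y -> P (f y b)) -> P x -> P (foldl f x s).
Proof. by move=> Pf; elim: s x => //= b s IH x Px; apply/IH/Pf. Qed.

(** * Signed tables and their cancellation *)

Section Classes.
Variables (K : fieldType) (d : int) (p q : nat).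
Local Notation cls x := (lproj (@iso_rel K d p q) x).

Definition signed_table : Type := (bool * seq (leg * nat))%type.

Definition represents v e (x : PreCY K d p q) (r : signed_table) : Prop :=
  exists2 G : ribbon v e p q, r.2 = table G & x = (-1) ^+ r.1 *: cls (gen K G).

(** Here [o] is the parity of d: exchanging two edges reverses the orientation for d even,
    exchanging two vertices for d odd. The guard admits arbitrary indices, such as defaults of
    [nth]. *)
Definition swap_edges_signed o e i j (r : signed_table) : signed_table :=
  if [&& (i < e)%N, (j < e)%N & i != j]
  then (r.1 (+) ~~ o, swap_edges p q e i j r.2) else r.

Definition swap_vertices_signed o v i j (r : signed_table) : signed_table :=
  if [&& (i < v)%N, (j < v)%N & i != j]
  then (r.1 (+) o, swap_vertices i j r.2) else r.

Lemma represents_swap_edges v e x r i j :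
  represents v e x r -> represents v e x (swap_edges_signed (odd `|d|%N) e i j r).
Proof.
case=> G rG Ex; rewrite /swap_edges_signed.
case: and3P => [[le_i le_j ne]|_]; last by exists G.
exists (relabel 1 (tperm (Ordinal le_i) (Ordinal le_j)) 1 1 G).
  by rewrite table_swap_edges /= rG.
rewrite Ex gen_relabel linearZ scalerA /= signr_addb -mulrA.
rewrite [X in _ = (_ * X) *: _](_ : _ = 1) ?mulr1 //.
rewrite /or_sign !odd_perm1 odd_tperm -val_eqE /= ne.
by case: (odd _); rewrite /= ?expr0 ?expr1 ?mulrNN mulr1.
Qed.

Lemma represents_swap_vertices v e x r i j :
  represents v e x r -> represents v e x (swap_vertices_signed (odd `|d|%N) v i j r).
Proof.
case=> G rG Ex; rewrite /swap_vertices_signed.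
case: and3P => [[le_i le_j ne]|_]; last by exists G.
exists (relabel (tperm (Ordinal le_i) (Ordinal le_j)) 1 1 1 G).
  by rewrite table_swap_vertices /= rG.
rewrite Ex gen_relabel linearZ scalerA /= signr_addb -mulrA.
rewrite [X in _ = (_ * X) *: _](_ : _ = 1) ?mulr1 //.
rewrite /or_sign !odd_perm1 odd_tperm -val_eqE /= ne.
by case: (odd _); rewrite /= ?expr0 ?expr1 ?mulrNN mulr1.
Qed.

Definition flip_leg (l : leg) : leg :=
  match l with
  | inl (inl j) => inr (inl j) | inr (inl j) => inl (inl j) | _ => l
  end.

Fixpoint explore e (T : seq (leg * nat)) n (todo seen : seq leg) : seq leg :=
  if n is n'.+1 then
    if todo is l :: todo' then
      if l \in seen then explore e T n' todo' seen
      else explore e T n' (flip_leg l :: next p q e T l :: todo') (rcons seen l)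
    else seen
  else seen.

(** Each newly met half-leg puts two entries on the agenda, which bounds the number of steps by
    three times the number of half-legs. *)
Definition explored e T := explore e T (3 * size (legs e p q)) [:: inr (inr 0%N)] [::].

Definition edge_label (l : leg) : option nat :=
  match l with inl (inl j) | inr (inl j) => Some j | _ => None end.

Definition edge_order e T := undup (pmap edge_label (explored e T)).
Definition vertex_order e T := undup [seq vlabel p q e T l | l <- explored e T].

(* Sorting the labels of the edges and of the vertices by the order in which  *)
(* they are met when exploring the graph from its first in-hair.  No property *)
(* of this order is needed: the sorting is a sequence of transpositions.      *)
Definition normalize o v e (r : signed_table) : signed_table :=
  let r' := foldl (fun r k =>
    swap_edges_signed o e (nth 0%N (edge_order e r.2) k) k r) r (iota 0 e) in
  foldl (fun r k =>
    swap_vertices_signed o v (nth 0%N (vertex_order e r.2) k) k r) r' (iota 0 v).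

Lemma represents_normalize v e x r :
  represents v e x r -> represents v e x (normalize (odd `|d|%N) v e r).
Proof.
move=> xr; rewrite /normalize.
apply: (@foldl_preserves _ _ (represents v e x)) => [y k|].
  exact: represents_swap_vertices.
apply: (@foldl_preserves _ _ (represents v e x)) => [y k|//].
exact: represents_swap_edges.
Qed.

(** Making the class a function of the table alone lets equal tables with opposite signs cancel
    formally; it is well defined by [table_inj]. *)
Definition table_class v e (T : seq (leg * nat)) : PreCY K d p q :=
  if [pick G : ribbon v e p q | table G == T] is Some G then cls (gen K G) else 0.

Lemma represents_class v e x r :
  represents v e x r -> x = (-1) ^+ r.1 *: table_class v e r.2.
Proof.
case=> G rG ->; rewrite /table_class; case: pickP => [H /eqP|/(_ G)/negbT/eqP[]//].
by rewrite rG => /table_inj->.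
Qed.

(** The fuel decreases once per removed pair, because [rem] is no structural subterm. *)
Fixpoint cancels n (s : seq signed_table) : bool :=
  if s is r :: s' then
    if n is n'.+1 then
      let r' := (~~ r.1, r.2) in (r' \in s') && cancels n' (rem r' s')
    else false
  else true.

Lemma cancels_sum n s (V : lmodType K) (f : seq (leg * nat) -> V) :
  cancels n s -> \sum_(r <- s) (-1) ^+ r.1 *: f r.2 = 0.
Proof.
elim: n s => [|n IH] [|[b T] s] //=; rewrite ?big_nil // => /andP[rs /IH s0].
rewrite big_cons (perm_big _ (perm_to_rem rs)) big_cons s0 /= addr0.
by rewrite -scalerDl; case: b {rs s0}; rewrite /= ?addNr ?subrr scale0r.
Qed.

Definition split_tables e T : seq (seq (leg * nat)) :=
  [seq split_table p q e T a b | a <- legs e p q, b <- [seq b <- legs e p q |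
     (b != a) && (vlabel p q e T b == vlabel p q e T a)]].

Definition diff_table o v e T : seq signed_table :=
  [seq normalize o v.+1 e.+1 (false, U) |
     U <- split_tables e T & table_admissible p q v.+1 e.+1 U].

(** Inadmissible splittings vanish in [gen], and [normalize] keeps track of the sign of the
    class. *)
Lemma diff_tableE v e (G : ribbon v e p q) : admissible G ->
  cls (graph_diff (gen K G)) =
  \sum_(r <- diff_table (odd `|d|%N) v e (table G))
    (-1) ^+ r.1 *: table_class v.+1 e.+1 r.2.
Proof.
move=> adG; rewrite graph_diff_gen // linear_sum big_map big_filter.
rewrite /split_tables [RHS]big_mkcond big_allpairs_dep /= legsE big_map big_enum.
apply: eq_bigr => a _.
rewrite linear_sum filter_map big_map big_filter big_enum_cond; apply: eq_big => b /=.
  by rewrite !vlabelE (inj_eq (@leg_of_inj _ _ _)) val_eqE.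
move=> _; rewrite -table_splitting -admissible_table.
case: ifP => [_|/negbT/gen_inadmissible->]; last by rewrite linear0.
apply: represents_class; apply: represents_normalize.
by exists (splitting G a b); rewrite //= scale1r.
Qed.

End Classes.

(* If a half-leg is fixed, then so are the other half-legs of its vertex, and *)
(* then those of the adjacent vertices.                                       *)
Lemma relabel_rigid v e p q (G : ribbon v e p q.+1) (t : 'S_v) (s : 'S_e) :
  admissible G -> relabel t s 1 1 G = G -> t = 1%g /\ s = 1%g.
Proof.
move=> adG E; pose l := hleg_perm s (1 : 'S_p) (1 : 'S_q.+1).
have lcyc h : l (cyc G h) = cyc G (l h) by rewrite -[in RHS]E cyc_relabel.
pose fixed u := forall h, vtx G h = u -> l h = h.
case/and4P: (adG) => /forallP vac /andP[_ /forallP conn] _ /forallP good.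
have fix_vertex h : l h = h -> fixed (vtx G h).
  move=> lh h' /esym Eh'; have : h' \in porbit (cyc G) h.
    by have /forallP/(_ h')/eqP <- := vac h; apply/eqP.
  case/porbitP=> n ->; elim: n => [|n IH]; first by rewrite expg0 perm1.
  by rewrite expgSr permM lcyc IH.
have ls j : l (esrc j) = esrc (s j) by exact: hleg_perm_src.
have lt j : l (etgt j) = etgt (s j) by exact: hleg_perm_tgt.
have fix_adjacent u w : adjacent G u w -> fixed u -> fixed w.
  case/orP=> /existsP[j /andP[/eqP <- /eqP <-]].
    move=> /(_ (esrc j) erefl); rewrite ls => -[sj].
    by apply: fix_vertex; rewrite lt sj.
  move=> /(_ (etgt j) erefl); rewrite lt => -[sj].
  by apply: fix_vertex; rewrite ls sj.
have all_fixed u : fixed u.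
  have /forallP/(_ u)/connectP[c Gc ->] := conn (vtx G (hin ord0)).
  have: fixed (vtx G (hin ord0)) by apply: fix_vertex; rewrite /l hleg_perm_in perm1.
  elim: c (vtx G (hin ord0)) Gc => //= x c IH y /andP[yx /IH{}IH] fy.
  by apply: IH; apply: fix_adjacent fy.
split; apply/permP => x; rewrite perm1.
  have /and3P[_ /existsP[h /andP[/eqP <- _]] _] := good x.
  by rewrite -{2}E -{2}[h](all_fixed _ _ erefl) vtx_relabel.
by have := all_fixed _ (esrc x) erefl; rewrite ls => -[].
Qed.

(** * Graphs given by the cycles at their vertices *)

Section GraphOfCycles.
Variables v e p q : nat.

(** As [inord] needs a nonempty range, the parameters are one less than the numbers of vertices,
    edges and hairs. *)
Definition hleg_of (l : leg) : hleg e.+1 p.+1 q.+1 :=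
  match l with
  | inl (inl j) => esrc (inord j) | inl (inr i) => hout (inord i)
  | inr (inl j) => etgt (inord j) | inr (inr i) => hin (inord i)
  end.

Lemma leg_ofK : cancel (@leg_of e.+1 p.+1 q.+1) hleg_of.
Proof. by move=> [[j|i]|[j|i]]; rewrite /= inord_val. Qed.

Lemma hleg_ofK : {in legs e.+1 p.+1 q.+1, cancel hleg_of (@leg_of _ _ _)}.
Proof. by move=> l; rewrite legsE => /mapP[h _ ->]; rewrite leg_ofK. Qed.

Definition cycle_next (c : seq leg) (l : leg) : leg :=
  if c is x :: c' then foldl (fun l y => swap x y l) l c' else l.

(** The cycle (x y z ...) is the product of the transpositions (x y), (x z), ..., from left to
    right. *)
Definition cycle_perm (c : seq leg) : {perm hleg e.+1 p.+1 q.+1} :=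
  if c is x :: c' then \prod_(y <- c') tperm (hleg_of x) (hleg_of y) else 1%g.

Definition graph_of_cycles (cs : seq (seq leg)) : ribbon v.+1 e.+1 p.+1 q.+1 :=
  Ribbon (\prod_(c <- cs) cycle_perm c)
    [ffun h => inord (find (fun c => leg_of h \in c) cs)].

Definition cycles_table (cs : seq (seq leg)) : seq (leg * nat) :=
  tabulate p.+1 q.+1 e.+1 (fun l =>
    (foldl (fun l c => cycle_next c l) l cs, find (fun c => l \in c) cs)).

Lemma cycle_nextE c h : all (mem (legs e.+1 p.+1 q.+1)) c ->
  leg_of (cycle_perm c h) = cycle_next c (leg_of h).
Proof.
case: c => [|x c] /=; first by rewrite perm1.
case/andP=> xL; elim: c h => [|y c IH] h /=; first by rewrite big_nil perm1.
case/andP=> yL cL; rewrite big_cons permM IH //.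
by rewrite (swapE _ _ _ (@leg_of_inj _ _ _)) !hleg_ofK.
Qed.

Definition valid_cycles (cs : seq (seq leg)) : bool :=
  [&& all (all (mem (legs e.+1 p.+1 q.+1))) cs, size cs == v.+1 &
      all (fun l => has (fun c => l \in c) cs) (legs e.+1 p.+1 q.+1)].

Lemma table_graph_of_cycles cs : valid_cycles cs ->
  table (graph_of_cycles cs) = cycles_table cs.
Proof.
case/and3P=> csL /eqP sz /allP cover; apply/esym/tabulateE => h; congr (_, _).
  rewrite /=; elim: cs csL h {sz cover} => [|c cs IH] /=.
    by move=> _ h; rewrite big_nil perm1.
  by case/andP=> cL csL h; rewrite big_cons permM -IH // cycle_nextE.
by rewrite ffunE inordK // -sz -has_find cover ?mem_legs.
Qed.

End GraphOfCycles.

(** * Tests on tables for the functional and its graphs *)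

Section TableTests.
Variables p q : nat.

Definition table_parallel e (T : seq (leg * nat)) : bool :=
  all (fun j => (j == 0%N) || has (fun k => [&& k != j,
      vlabel p q e T (inl (inl k)) == vlabel p q e T (inl (inl j)) &
      vlabel p q e T (inr (inl k)) == vlabel p q e T (inr (inl j))]) (iota 0 e))
    (iota 0 e).

Lemma parallel_edges_table v e (G : ribbon v e.+1 p q) :
  table_parallel e.+1 (table G) -> parallel_edges G.
Proof.
move=> /allP par j j0; have jI : val j \in iota 0 e.+1.
  by rewrite mem_iota add0n ltn_ord.
have /orP[j0'|/hasP[k]] := par _ jI; first by rewrite -val_eqE j0' in j0.
rewrite mem_iota => /andP[_ ke] /and3P[kj /eqP Es /eqP Et].
by exists (Ordinal ke) => //; split; apply: val_inj; rewrite /= -!vlabelE.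
Qed.

Definition reverse_table e (T : seq (leg * nat)) : seq (leg * nat) :=
  let f := swap src0 tgt0 in
  tabulate p q e (fun l => (f (next p q e T (f l)), vlabel p q e T (f l))).

Lemma table_reverse0 v e (G : ribbon v e.+1 p q) :
  table (reverse0 G) = reverse_table e.+1 (table G).
Proof.
apply/esym/tabulateE => h.
rewrite -[src0]/(leg_of (esrc ord0 : hleg e.+1 p q)).
rewrite -[tgt0]/(leg_of (etgt ord0 : hleg e.+1 p q)).
rewrite -!(swapE _ _ _ (@leg_of_inj _ _ _)) nextE vlabelE.
rewrite -(swapE _ _ _ (@leg_of_inj _ _ _)) ffunE; congr (leg_of _, _).
by rewrite -[in RHS](tpermK (esrc ord0) (etgt ord0) h) permJ.
Qed.

(* The kinds of the four half-legs that follow each in-hair, edges being      *)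
(* recorded only up to their names.                                           *)
Definition hair_walks e (T : seq (leg * nat)) : seq (seq leg) :=
  [seq [seq relabel_leg (fun=> 0%N) (iter k (next p q e T) (inr (inr i))) | k <- iota 0 4]
     | i <- iota 0 q].

(** Relabelling fixes the in-hairs, commutes with going around a vertex, and changes only the names
    of edges, which the walks forget. *)
Lemma hair_walks_relabel v e (G : ribbon v e p q) (t : 'S_v) (s : 'S_e) :
  hair_walks e (table (relabel t s 1 1 G)) = hair_walks e (table G).
Proof.
rewrite /hair_walks -(val_enum_ord q) -!map_comp; apply: eq_map => i.
have iterE (H : ribbon v e p q) k (h : hleg e p q) :
    iter k (next p q e (table H)) (leg_of h) = leg_of (iter k (cyc H) h).
  by elim: k => //= k ->; rewrite nextE.
apply: eq_map => k.
rewrite -[inr (inr (val i))]/(leg_of (hin i : hleg e p q)) !iterE.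
rewrite -{1}[hin i](_ : hleg_perm s (1 : 'S_p) (1 : 'S_q) (hin i) = _);
  last by rewrite hleg_perm_in perm1.
have -> : iter k (cyc (relabel t s 1 1 G)) (hleg_perm s 1 1 (hin i))
        = hleg_perm s 1 1 (iter k (cyc G) (hin i)).
  by elim: k => //= k ->; rewrite cyc_relabel.
case: (iter _ _ _) => [[j|j]|[j|j]].
- by rewrite hleg_perm_src.
- by rewrite hleg_perm_out perm1.
- by rewrite hleg_perm_tgt.
- by rewrite hleg_perm_in perm1.
Qed.

Lemma coord_hair_walks (K : fieldType) d v e (P G : ribbon v e p q) :
  hair_walks e (table G) != hair_walks e (table P) -> coord K d P G = 0.
Proof.
move=> ne; apply: coord_eq0 => t s /any_ribbon_inj E.
by rewrite E hair_walks_relabel eqxx in ne.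
Qed.

Lemma valency_ge4_table v e (G : ribbon v e p q) :
  has (fun u => 4 <= table_valency p q e (table G) u)%N (iota 0 v) ->
  has_valency_ge4 G.
Proof.
case/hasP=> u; rewrite mem_iota => /andP[_ uv] le; apply/existsP.
by exists (Ordinal uv); rewrite -table_valencyE.
Qed.

End TableTests.

(** By [relabel_rigid], only the identity relabelling contributes. *)
Lemma coord_self (K : fieldType) d v e p q (P : ribbon v e p q.+1) :
  admissible P -> coord K d P P = 1.
Proof.
move=> adP; have r1 : relabel 1 1 1 1 P = P.
  by apply: (@relabel_inj _ _ _ _ 1 1); rewrite relabelM !mulg1.
rewrite coordE (bigD1 1%g) //= (bigD1 1%g) //= r1 eqxx.
rewrite big1 => [|s s1]; last first.
  by case: eqP => // /esym/(relabel_rigid adP)[_ /eqP]; rewrite (negbTE s1).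
rewrite big1 => [|t t1]; last first.
  apply: big1 => s _.
  by case: eqP => // /esym/(relabel_rigid adP)[/eqP]; rewrite (negbTE t1).
by rewrite /or_sign !odd_perm1 !addr0; case: ifP.
Qed.

(** * The sixteen graphs of the cohomology class *)

Section Witness.

Let s0 : leg := inl (inl 0%N).
Let s1 : leg := inl (inl 1%N).
Let s2 : leg := inl (inl 2%N).
Let t0 : leg := inr (inl 0%N).
Let t1 : leg := inr (inl 1%N).
Let t2 : leg := inr (inl 2%N).
Let o0 : leg := inl (inr 0%N).
Let o1 : leg := inl (inr 1%N).
Let i0 : leg := inr (inr 0%N).
Let i1 : leg := inr (inr 1%N).

(* The labels are chosen so that all coefficients of the cocycle are 1, for   *)
(* both parities of d.                                                        *)
Definition witness_cycles : seq (seq (seq leg)) :=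
  [:: [:: [:: i0; o0; s0]; [:: t0; s1; i1; s2]; [:: t1; t2; o1]];
      [:: [:: i0; o0; s0]; [:: t0; s1; s2]; [:: t1; t2; i1; o1]];
      [:: [:: i0; o0; s0; s1]; [:: t2; i1; o1]; [:: t0; t1; s2]];
      [:: [:: i0; s0; s1]; [:: t2; i1; o1]; [:: t0; o0; t1; s2]];
      [:: [:: i0; o0; s0]; [:: s2; s1; i1]; [:: t0; t2; o1; t1]];
      [:: [:: i0; o0; s0]; [:: t0; s1; s2]; [:: t1; t2; o1; i1]];
      [:: [:: i0; o0; s0; s1]; [:: t2; o1; i1]; [:: t0; t1; s2]];
      [:: [:: i0; s0; s1]; [:: t0; t2; i1; o1]; [:: t1; s2; o0]];
      [:: [:: i0; s0; s2; s1]; [:: t2; i1; o1]; [:: t0; o0; t1]];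
      [:: [:: i0; s0; s1]; [:: t2; o1; i1]; [:: t0; o0; t1; s2]];
      [:: [:: i0; s0; s2; o0]; [:: t2; i1; s1]; [:: t0; t1; o1]];
      [:: [:: i0; s0; s1]; [:: t0; t2; o1; i1]; [:: t1; s2; o0]];
      [:: [:: i0; s0; s2; s1]; [:: t2; o1; i1]; [:: t0; o0; t1]];
      [:: [:: i0; s0; o0]; [:: t0; s1; i1; s2]; [:: t1; t2; o1]];
      [:: [:: i0; s0; o0]; [:: s2; s1; i1]; [:: t0; t2; o1; t1]];
      [:: [:: i0; s0; s2; o0]; [:: t0; s1; i1]; [:: t2; o1; t1]]].

End Witness.

Local Notation witness_graph cs := (graph_of_cycles 2 2 1 1 cs).

Lemma witness_checks : all (fun cs => [&& valid_cycles 2 2 1 1 cs,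
    table_admissible 2 2 3 3 (cycles_table 2 1 1 cs) &
    has (fun u => 4 <= table_valency 2 2 3 (cycles_table 2 1 1 cs) u)%N (iota 0 3)])
  witness_cycles.
Proof. by vm_compute. Qed.

Lemma witness_table cs : cs \in witness_cycles ->
  table (witness_graph cs) = cycles_table 2 1 1 cs.
Proof. by move=> /(allP witness_checks)/and3P[/table_graph_of_cycles]. Qed.

Lemma witness_admissible cs : cs \in witness_cycles -> admissible (witness_graph cs).
Proof.
move=> csW; have /and3P[_ ad _] := allP witness_checks _ csW.
by rewrite admissible_table witness_table.
Qed.

Lemma witness_ge4 cs : cs \in witness_cycles -> has_valency_ge4 (witness_graph cs).
Proof.
move=> csW; have /and3P[_ _ ge4] := allP witness_checks _ csW.
by apply: valency_ge4_table; rewrite witness_table.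
Qed.

Definition first_graph : ribbon 3 3 2 2 := witness_graph (head [::] witness_cycles).

Lemma first_in_witness : head [::] witness_cycles \in witness_cycles.
Proof. by []. Qed.

Lemma first_table : table first_graph = cycles_table 2 1 1 (head [::] witness_cycles).
Proof. exact: witness_table first_in_witness. Qed.

Lemma first_admissible : admissible first_graph.
Proof. exact: witness_admissible first_in_witness. Qed.

Lemma reversed_admissible : admissible (reverse0 first_graph).
Proof. by rewrite admissible_table table_reverse0 first_table; vm_compute. Qed.

Lemma first_parallel : parallel_edges first_graph.
Proof. by apply: parallel_edges_table; rewrite first_table; vm_compute. Qed.

Lemma reversed_parallel : parallel_edges (reverse0 first_graph).
Proof.
by apply: parallel_edges_table; rewrite table_reverse0 first_table; vm_compute.
Qed.

(** This separates the other fifteen graphs from [P] and from its reversal, so that they do not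
    contribute to the functional. *)
Lemma other_walks :
  let TP := cycles_table 2 1 1 (head [::] witness_cycles) in
  all (fun cs => let w := hair_walks 2 2 3 (cycles_table 2 1 1 cs) in
      (w != hair_walks 2 2 3 TP) && (w != hair_walks 2 2 3 (reverse_table 2 2 3 TP)))
    (rem (head [::] witness_cycles) witness_cycles).
Proof. by vm_compute. Qed.

(** * The class is closed, dies in [BIB] and is not exact *)

Section Nonexactness.
Variables (K : fieldType) (d : int).

Definition witness : graph_space K 2 2 :=
  \sum_(cs <- witness_cycles) gen K (witness_graph cs).

Lemma witness_closed : PreCY_diff (hq_class d witness) = 0.
Proof.
rewrite PreCY_diff_class.
transitivity (\sum_(cs <- witness_cycles)
    \sum_(r <- diff_table 2 2 (odd `|d|%N) 3 3 (cycles_table 2 1 1 cs))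
      (-1) ^+ r.1 *: table_class K d 2 2 4 4 r.2).
  rewrite /hq_class /witness [graph_diff _]linear_sum linear_sum /=.
  apply: eq_big_seq => cs csW.
  by rewrite -(witness_table csW); apply/diff_tableE/witness_admissible.
rewrite -(big_map _ predT (fun s => \sum_(r <- s) _)) -big_flatten.
(* The signs depend on d only through its parity, so two computations cover all d. The fuel 40 is at
   least the number of cancelling pairs. *)
apply: (@cancels_sum _ 40); case: (odd _); by vm_compute.
Qed.

Lemma witness_homogeneous :
  PreCY_deg (d * 3%:Z + (1 - d) * 3%:Z + (2 - d) * 2%:Z - 2%:Z) (hq_class d witness).
Proof.
rewrite /hq_class /witness linear_sum big_seq.
elim/big_ind: _ => [|x y|cs csW]; [exact: lspan0|exact: lspanD|apply: lspan_in].
rewrite (gen_admissible _ (witness_admissible csW)).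
by exists (hquiver_of (witness_admissible csW)).
Qed.

Lemma witness_ideal : BIB_proj (hq_class d witness) = 0.
Proof.
apply/lproj_eq0; rewrite /hq_class /witness linear_sum big_seq.
elim/big_ind: _ => [|x y|cs csW]; [exact: lspan0|exact: lspanD|apply: lspan_in].
move=> J Jid _ J4; apply: J4 => J' _ ge4.
rewrite (gen_admissible _ (witness_admissible csW)); apply: ge4.
exact: witness_ge4.
Qed.

(** The first graph has coefficient 1 at itself and, by its hair walks, 0 at its reversal. *)
Lemma cocycle_witness : cocycle d first_graph witness = 1.
Proof.
have cocycle_gen (G : ribbon 3 3 2 2) : cocycle d first_graph (gen K G) =
    coord K d first_graph G
      - (if odd `|d|%N then -1 else 1) * coord K d (reverse0 first_graph) G.
  by rewrite /cocycle !coordinate_gen ?first_admissible ?reversed_admissible.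
have -> : cocycle d first_graph witness =
    \sum_(cs <- witness_cycles) cocycle d first_graph (gen K (witness_graph cs)).
  by rewrite /witness linear_sum.
rewrite (big_rem _ first_in_witness) big_seq big1 => [|cs csW].
  transitivity (cocycle d first_graph (gen K first_graph)); first exact: addr0.
  rewrite cocycle_gen coord_self ?first_admissible // coord_hair_walks ?mulr0 ?subr0 //.
  by rewrite table_reverse0 first_table; vm_compute.
have csW' := mem_rem csW; have := allP other_walks _ csW.
rewrite -(witness_table csW') -first_table -table_reverse0 => /andP[ne ne'].
by rewrite cocycle_gen !coord_hair_walks ?mulr0 ?subr0.
Qed.

Lemma witness_not_exact z : hq_class d witness <> PreCY_diff z.
Proof.
rewrite -[z]lproj_repr; move: (repr z) => f; rewrite PreCY_diff_class => /lquotP Rwf.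
have [adP adP'] := (first_admissible, reversed_admissible).
have [parP parP'] := (first_parallel, reversed_parallel).
suff: cocycle d first_graph (witness - graph_diff f) = 0.
  rewrite linearB /= cocycle_diff // subr0 cocycle_witness => /eqP.
  by rewrite oner_eq0.
exact: cocycle_iso_rel Rwf.
Qed.

End Nonexactness.

Theorem proposition5p10p1 (K : fieldType) (charK0 : [pchar K]%R =i pred0) (d : int) :
  ~ BIB_koszul K d.
Proof.
(* The degree of a graph with three vertices, three edges, two out-hairs and two in-hairs. *)
pose n : int := d * 3%:Z + (1 - d) * 3%:Z + (2 - d) * 2%:Z - 2%:Z.
move=> /(_ 2%N 2%N isT isT n)[exact_ker _].
have [|z _ /witness_not_exact//] :=
  exact_ker _ (witness_homogeneous K d) (witness_closed K d).
(* In [BIB] the image of [witness] is zero, hence the boundary of 0. *)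
exists 0; last by rewrite linear0 witness_ideal.
by exists 0; rewrite ?linear0 //; exact: lspan0.
Qed.
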